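(* Let $d\ge 1$ and consider nearest-neighbor random walk on $\mathbb{Z}^d$ in a uniformly elliptic space--time product environment. For every $\xi\in\mathrm{int}(\mathcal{D})$, all $N,M,K\in\mathbb{N}$, every bounded measurable function $f:\Omega\times U^{\mathbb{N}}\to\mathbb{R}$ such that $f(\cdot,(z_i)_{i\ge1})$ is independent of $(z_i)_{i>K}$ and is $\mathcal{B}_{-N}^+\cap\mathcal{B}_M^-$-measurable for each $(z_i)_{i\ge1}$, and every $\epsilon>0$, there exists $\delta_o>0$ such that for every $\delta$ with $0<\delta<\delta_o$, $$\limsup_{n\to\infty}\frac1n\log P_{o,o}\bigl(A_{\xi,n}^{\epsilon}(f)\,\big|\,D_{\xi,n}^{\delta}\bigr)<0,$$ where $$A_{\xi,n}^\epsilon(f)=\Bigl\{\Bigl|\frac1n\sum_{j=0}^{n-1}f\bigl(T_{j,X_j}\omega,(Z_{j+i})_{i\ge1}\bigr)-\int f\,d\overline{\mu}_\xi^\infty\Bigr|>\epsilon\Bigr\},\qquad D_{\xi,n}^\delta=\Bigl\{\Bigl|\frac{X_n}{n}-\xi\Bigr|\le\delta\Bigr\}.$$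
   Context: Environment. $U=\{z\in\mathbb{Z}^d: |z|=1\}$. An environment is $\omega=(\omega_{n,x})_{n\in\mathbb{Z},x\in\mathbb{Z}^d}$, where $\omega_{n,x}=(\pi_{n,n+1}(x,x+y))_{y\in\mathbb{Z}^d}$ is a probability vector. $\Omega$ is the product space of all environments, with Borel $\sigma$-algebra $\mathcal{B}$, and $\mathbb{P}$ is a product probability measure on $\Omega$ under which the $\omega_{n,x}$ are i.i.d. Standing assumptions: (nearest-neighbor) $\mathbb{P}(\pi_{0,1}(0,z)>0)=0$ unless $z\in U$; (uniform ellipticity) there is a constant $c>0$ with $\mathbb{P}(\pi_{0,1}(0,z)\ge c)=1$ for all $z\in U$. $\mathcal{B}_n^+$ (resp. $\mathcal{B}_n^-$) is the $\sigma$-algebra generated by $(\omega_{m,x}: x\in\mathbb{Z}^d, m\ge n)$ (resp. $m\le n$). Shifts: $(T_{m,y}\omega)_{n,x}=\omega_{n+m,x+y}$. Walk. For fixed $\omega$, $P_{k,x}^\omega$ (the quenched measure) is the law of the Markov chain $(X_n)_{n\ge k}$ with $X_k=x$ and probability $\pi_{n,n+1}(y,y+z)$ of stepping from $y$ at time $n$ to $y+z$ at time $n+1$. The averaged measure is the semi-direct product $P_{k,x}=\mathbb{P}\times P_{k,x}^\omega$ on environments and paths. Expectations: $\mathbb{E},E_{k,x}^\omega,E_{k,x}$. The subscript $o,o$ means start at position $0$ at time $0$. $Z_{n+1}=X_{n+1}-X_n$. Averaged rate function. $q(z)=\mathbb{E}[\pi_{0,1}(0,z)]$, $\phi(\theta)=\sum_{z\in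 U}q(z)e^{\langle\theta,z\rangle}$ for $\theta\in\mathbb{R}^d$, $I_a(\xi)=\sup_{\theta\in\mathbb{R}^d}\{\langle\theta,\xi\rangle-\log\phi(\theta)\}$, and $\mathcal{D}=\{\xi\in\mathbb{R}^d: I_a(\xi)<\infty\}$. Measure $\overline{\mu}_\xi^\infty$. For $\xi\in\mathrm{int}(\mathcal{D})$ there is a unique $\theta\in\mathbb{R}^d$ with $\xi=\nabla\log\phi(\theta)$. $\overline{\mu}_\xi^\infty$ is the probability measure on $\Omega\times U^{\mathbb{N}}$ determined by $$\int f\,d\overline{\mu}_\xi^\infty=E_{o,o}\bigl[e^{\langle\theta,X_{N+M+K+1}\rangle-(N+M+K+1)\log\phi(\theta)}f(T_{N,X_N}\omega,(Z_{N+i})_{i\ge1})\bigr]$$ for all $N,M,K\in\mathbb{N}$ and all bounded measurable $f:\Omega\times U^{\mathbb{N}}\to\mathbb{R}$ such that $f(\cdot,(z_i)_{i\ge1})$ is independent of $(z_i)_{i>K}$ and $\mathcal{B}_{-N}^+\cap\mathcal{B}_M^-$-measurable for each $(z_i)_{i\ge1}$. Convention: $\log 0=-\infty$. *)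

(* Defs.v *)
From HB Require Import structures.
From mathcomp Require Import all_boot all_order all_algebra.
From mathcomp Require Import all_classical all_reals all_analysis.
Set Implicit Arguments.
Unset Strict Implicit.
Unset Printing Implicit Defensive.
Import Order.TTheory GRing.Theory Num.Theory.
Import numFieldNormedType.Exports.
Local Open Scope classical_set_scope.
Local Open Scope ring_scope.

Section product_sigma_algebra.
Context (I : Type) {disp : measure_display} (T : measurableType disp).

Definition prod_fun : Type := I -> T.

Definition cylinder : set (set prod_fun) :=
  [set B | exists (i : I) (A : set T), measurable A /\ B = [set g | A (g i)]].

HB.instance Definition _ := Pointed.on prod_fun.
HB.instance Definition _ := @isMeasurable.Build (sigma_display cylinder)
  prod_fun <<s cylinder >> (@sigma_algebra0 _ setT _)
  (@sigma_algebraC _ _) (@sigma_algebra_bigcup _ setT _).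

End product_sigma_algebra.

(* Z^d; the dimension is written d.+1 throughout, so that it is at least 1. *)
Definition lattice (d : nat) : Type := 'rV[int]_d.+1.
HB.instance Definition _ d := GRing.Zmodule.on (lattice d).
HB.instance Definition _ d := isPointed.Build (lattice d) 0.
HB.instance Definition _ d := @isMeasurable.Build default_measure_display
  (lattice d) discrete_measurable discrete_measurable0
  discrete_measurableC discrete_measurableU.

Section space.
Variables (R : realType) (d : nat).

Definition embed (z : lattice d) : 'rV[R]_d.+1 :=
  map_mx (fun k : int => k%:~R) z.

Definition dot (x y : 'rV[R]_d.+1) : R := \sum_i x 0 i * y 0 i.

(* Euclidean, whereas the library norm of a matrix is the sup norm. *)
Definition enorm (x : 'rV[R]_d.+1) : R := Num.sqrt (dot x x).

Definition on_sphere : pred (lattice d) := [pred z | enorm (embed z) == 1].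

Definition unit_step : Type := {z : lattice d | on_sphere z}.

Fact delta_on_sphere : on_sphere (delta_mx 0 0 : 'rV[int]_d.+1).
Proof.
rewrite /on_sphere /= /enorm /dot (bigD1 0)//= big1 ?addr0.
  by rewrite !mxE !eqxx /= mulr1 sqrtr1.
by move=> i i0; rewrite !mxE (negbTE i0) andbF mulr0.
Qed.

HB.instance Definition _ := Choice.on unit_step.
HB.instance Definition _ := SubType.on unit_step.
HB.instance Definition _ := isPointed.Build unit_step
  (exist _ (delta_mx 0 0 : lattice d) delta_on_sphere).
HB.instance Definition _ := @isMeasurable.Build default_measure_display
  unit_step discrete_measurable discrete_measurable0
  discrete_measurableC discrete_measurableU.

Record pvec := PVec {
  pv :> lattice d -> R ;
  pv_ge0 : forall y, 0 <= pv y ;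
  pv_sum1 : \esum_(y in [set: lattice d]) (pv y)%:E = 1%E }.

Fact dirac0_ge0 (y : lattice d) : 0 <= (y == 0)%:R :> R.
Proof. exact: ler0n. Qed.

Fact dirac0_sum1 :
  (\esum_(y in [set: lattice d]) ((y == 0)%:R : R)%:E)%E = 1%E.
Proof.
rewrite (esumID [set (0 : lattice d)]); last first.
  by move=> y _; rewrite lee_fin ler0n.
rewrite !setTI esum_set1 ?eqxx ?lee_fin ?ler01// esum1 ?adde0//.
by move=> y /= /eqP/negbTE ->.
Qed.

HB.instance Definition _ := gen_eqMixin pvec.
HB.instance Definition _ := gen_choiceMixin pvec.
HB.instance Definition _ := isPointed.Build pvec (PVec dirac0_ge0 dirac0_sum1).

Definition pvec_cylinder : set (set pvec) :=
  [set B | exists (y : lattice d) (A : set R),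
     measurable A /\ B = [set p : pvec | A (p y)]].

HB.instance Definition _ := @isMeasurable.Build (sigma_display pvec_cylinder)
  pvec <<s pvec_cylinder >> (@sigma_algebra0 _ setT pvec_cylinder)
  (@sigma_algebraC _ pvec_cylinder) (@sigma_algebra_bigcup _ setT pvec_cylinder).

Definition site : Type := (int * lattice d)%type.

(* w (n, x) z is the probability of stepping from x at time n to x + z at
   time n + 1. *)
Definition env : Type := prod_fun site pvec.

Definition traj : Type := prod_fun nat (lattice d).

(* Steps are numbered from 0: z i stands for the (i+1)-st step. *)
Definition steps : Type := prod_fun nat unit_step.

End space.

Section semidirect.
Context {R : realType} {d1 d2 : measure_display}
  {T1 : measurableType d1} {T2 : measurableType d2}.
Variables (P : probability T1 R) (Q : R.-pker T1 ~> T2).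
Local Open Scope ereal_scope.

Definition semidirect (B : set (T1 * T2)) : \bar R :=
  \int[P]_w Q w (xsection B w).

Let semidirect0 : semidirect set0 = 0.
Proof.
by rewrite /semidirect; apply: integral0_eq => w _; rewrite xsection0 measure0.
Qed.

Let semidirect_ge0 B : 0 <= semidirect B.
Proof. exact: integral_ge0. Qed.

Let semidirect_sigma_additive : semi_sigma_additive semidirect.
Proof.
move=> F mF tF mUF; rewrite [X in _ --> X](_ : _ =
    \sum_(0 <= i <oo) semidirect (F i)).
  by apply: is_cvg_ereal_nneg_natsum => n _; exact: semidirect_ge0.
rewrite /semidirect -(@integral_nneseries _ _ R P _ measurableT
  (fun i w => Q w (xsection (F i) w)))//; last first.
  by move=> n; apply: measurable_fun_xsection_finite_kernel; rewrite inE.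
apply: eq_integral => w _.
rewrite xsection_bigcup measure_semi_bigcup//.
- by move=> n; exact: measurable_xsection.
- exact: trivIset_xsection.
- by rewrite -xsection_bigcup; exact: measurable_xsection.
Qed.

HB.instance Definition _ := isMeasure.Build _ _ _ semidirect
  semidirect0 semidirect_ge0 semidirect_sigma_additive.

Let semidirect_setT : semidirect setT = 1.
Proof.
rewrite /semidirect -(@probability_setT _ _ _ P) -[RHS]mul1e -integral_cst//.
by apply: eq_integral => w _; rewrite xsectionE preimage_setT prob_kernel.
Qed.

HB.instance Definition _ :=
  Measure_isProbability.Build _ _ _ semidirect semidirect_setT.

End semidirect.

Section walk.
Variables (R : realType) (d : nat).
Implicit Types (P : probability (env R d) R) (Q : R.-pker (env R d) ~> traj d).

Definition iid P : Prop :=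
  exists nu : probability (pvec R d) R,
    forall (l : seq (site d)) (A : site d -> set (pvec R d)),
      uniq l -> (forall s, measurable (A s)) ->
      P [set w : env R d | forall s, s \in l -> A s (w s)] =
      (\prod_(s <- l) nu (A s))%E.

Definition nearest_neighbor P : Prop :=
  forall z : lattice d, ~~ on_sphere R z ->
    P [set w : env R d | 0 < w (0, 0) z] = 0%E.

Definition uniformly_elliptic P : Prop :=
  exists2 c : R, 0 < c &
    forall z : lattice d, on_sphere R z ->
      P [set w : env R d | c <= w (0, 0) z] = 1%E.

(* Q w is the law, under w, of the walk started at position 0 at time 0. *)
Definition quenched_law Q : Prop :=
  forall (w : env R d) (n : nat) (x : traj d), x 0%N = 0 ->
    Q w [set X | forall i, (i <= n)%N -> X i = x i] =
    (\prod_(i < n) w (i%:Z, x i) (x i.+1 - x i))%:E.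

Definition sigma_from (n : int) : set (set (env R d)) :=
  <<s [set B | exists (s : site d) (A : set (pvec R d)),
         n <= s.1 /\ measurable A /\ B = [set w : env R d | A (w s)]] >>.

Definition sigma_upto (n : int) : set (set (env R d)) :=
  <<s [set B | exists (s : site d) (A : set (pvec R d)),
         s.1 <= n /\ measurable A /\ B = [set w : env R d | A (w s)]] >>.

Definition shift_env (m : int) (y : lattice d) (w : env R d) : env R d :=
  fun s => w (s.1 + m, s.2 + y).

(* Increments outside the unit sphere, which have probability 0 under the
   averaged measure, are replaced by an arbitrary unit vector. *)
Definition steps_after (n : nat) (X : traj d) : steps R d :=
  fun i => insubd (point : unit_step R d) (X (n + i).+1 - X (n + i)%N).

Definition local_observable (N M K : nat) (f : env R d * steps R d -> R) :
    Prop :=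
  [/\ measurable_fun setT f,
      exists C : R, forall p, `|f p| <= C,
      forall w (z z' : steps R d), (forall i, (i < K)%N -> z i = z' i) ->
        f (w, z) = f (w, z') &
      forall (z : steps R d) (B : set R), measurable B ->
        (sigma_from (- N%:Z) `&` sigma_upto M%:Z)
          [set w : env R d | B (f (w, z))]].

Definition mean_step P (z : lattice d) : R := \int[P]_w w (0, 0) z.

Definition phi P (theta : 'rV[R]_d.+1) : R :=
  \sum_(z \in [set z | on_sphere R z]) mean_step P z * expR (dot theta (embed R z)).

Definition rate_a P (xi : 'rV[R]_d.+1) : \bar R :=
  ereal_sup [set (dot theta xi - ln (phi P theta))%:E | theta in setT].

Definition dom_rate P : set 'rV[R]_d.+1 := [set xi | (rate_a P xi < +oo)%E].

Definition grad_log_phi P (theta xi : 'rV[R]_d.+1) : Prop :=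
  forall i, is_derive theta (delta_mx 0 i : 'rV[R]_d.+1)
    (fun t => ln (phi P t)) (xi 0 i).

Definition is_mu_bar P Q (xi : 'rV[R]_d.+1)
    (mu : probability (env R d * steps R d)%type R) : Prop :=
  exists2 theta : 'rV[R]_d.+1, grad_log_phi P theta xi &
    forall (N M K : nat) (f : env R d * steps R d -> R),
      local_observable N M K f ->
      (\int[mu]_p (f p)%:E =
       \int[semidirect P Q]_p
         (expR (dot theta (embed R (p.2 (N + M + K + 1)%N))
                - (N + M + K + 1)%:R * ln (phi P theta))
          * f (shift_env N%:Z (p.2 N) p.1, steps_after N p.2))%:E)%E.

Definition deviation (f : env R d * steps R d -> R)
    (mu : probability (env R d * steps R d)%type R) (n : nat) (eps : R) :
    set (env R d * traj d) :=
  [set p : env R d * traj d | eps < `| n%:R^-1 *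
       (\sum_(j < n) f (shift_env j%:Z (p.2 j) p.1, steps_after j p.2))
       - \int[mu]_r f r |].

Definition near_velocity (xi : 'rV[R]_d.+1) (n : nat) (delta : R) :
    set (env R d * traj d) :=
  [set p : env R d * traj d | enorm (n%:R^-1 *: embed R (p.2 n) - xi) <= delta].

Definition cond_prob {disp} {T : measurableType disp} (Pr : probability T R)
  (A B : set T) : \bar R := (Pr (A `&` B) / Pr B)%E.

End walk.

(* Main.v *)
(* Weighting each step z of the walk by e^<theta,z> / phi(theta) multiplies the
   probability of any event contained in D_n by e^(n I_a(xi)), up to a factor
   e^(O(n delta)), so these weights cancel in the conditional probability.
   Recentering every time level of the environment at the current position of
   the walk turns the averaged measure, tilted or not, into the law of i.i.d.
   pairs (environment level, step): a product environment has independent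
   levels, and each of them is shift invariant.  The observable f sees only
   N + M + K + 1 consecutive pairs, so the ergodic sum splits along residue
   classes into sums of i.i.d. bounded terms whose tilted mean is the integral
   of f, and Chernoff's bound yields exponential decay at a rate that does not
   depend on delta.  Chernoff's bound for X_n, whose tilted drift is
   xi = grad log phi (theta), shows that D_n has tilted probability at least 1/2
   for large n.  It remains to take delta small with respect to the rate. *)
Require Import Defs.
From HB Require Import structures.
From mathcomp Require Import all_boot all_order all_algebra.
From mathcomp Require Import all_classical all_reals all_analysis.
From mathcomp Require Import measurable_realfun.
From mathcomp Require Import zify ring lra.
Set Implicit Arguments.
Unset Strict Implicit.
Unset Printing Implicit Defensive.
Import Order.TTheory GRing.Theory Num.Theory.
Import numFieldNormedType.Exports.
Local Open Scope classical_set_scope.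
Local Open Scope ring_scope.

(** * Product laws on environments *)

(** Two choices shape the development. The tilted law is never built as a measure: [tilted] is a
    finite sum, over nearest-neighbor paths of one fixed length, of integrals against [P], and
    passing from one length to another rests on the step weights having total mass one. Moreover
    every functional integrated is nonnegative, so that Tonelli applies without integrability
    conditions; a signed observable bounded by C enters as itself plus C, and its mean m as m + C.

    Two boundary effects cost only constants. The ergodic sum up to time n reads the path up to time
    n + L with L = N + M + K + 1, whereas D_n controls it at time n only; the L extra steps change
    the weight by a bounded factor because steps have norm 1. A window also starts N levels before
    the time at which f is evaluated, so the first N terms of the sum, which may read negative
    levels, are traded for later ones; this moves the average by O(1/n), which is absorbed in half
    of epsilon. *)

Section measurability.
Context {disp dispT : measure_display}.

Lemma measurable_fun_prod_fun (I : Type) (T : measurableType disp)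
    (S : measurableType dispT) (h : S -> prod_fun I T) :
  (forall i, measurable_fun setT (fun s => h s i)) -> measurable_fun setT h.
Proof.
move=> mh; apply: (@measurability _ _ _ (prod_fun I T) setT h (@cylinder I _ T)) => //.
move=> _ [B [i [A [mA ->]]] <-].
exact: mh.
Qed.

Lemma measurable_prod_fun_eval (I : Type) (T : measurableType disp) (i : I) :
  measurable_fun setT (fun g : prod_fun I T => g i).
Proof.
move=> _ A mA; rewrite setTI; apply: sub_sigma_algebra; by exists i, A.
Qed.

End measurability.

Lemma measurable_pvec_eval (R : realType) (d : nat) (y : lattice d) :
  measurable_fun setT (fun p : pvec R d => p y).
Proof.
move=> _ A mA; rewrite setTI; apply: sub_sigma_algebra; by exists y, A.
Qed.

Lemma measurable_env_eval (R : realType) (d : nat) (s : site d) (y : lattice d) :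
  measurable_fun setT (fun w : env R d => w s y).
Proof.
apply: (measurableT_comp (measurable_pvec_eval y)).
exact: measurable_prod_fun_eval.
Qed.

Lemma lattice_countable (d : nat) : countable [set: lattice d].
Proof. exact: (@countableP 'rV[int]_d.+1). Qed.

(** Needed because the environment is read at the random position of the walk: as the lattice is
    countable, a preimage splits into countably many pieces according to the value of [y]. *)
Lemma measurable_fun_lattice_index (d1 d2 : measure_display) (d : nat)
    (T : measurableType d1) (S : measurableType d2) (y : T -> lattice d)
    (g : lattice d -> T -> S) :
  measurable_fun setT y -> (forall z, measurable_fun setT (g z)) ->
  measurable_fun setT (fun x => g (y x) x).
Proof.
move=> my mg _ A mA; rewrite setTI.
rewrite [X in measurable X](_ : _ =
   \bigcup_(z in [set: lattice d]) (y @^-1` [set z] `&` g z @^-1` A)); last first.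
  apply/seteqP; split => x /=; first by move=> Ax; exists (y x).
  by move=> [z _ [/= <-]].
apply: countable_bigcupT_measurable; first exact: lattice_countable.
move=> z; apply: measurableI; rewrite -[X in measurable X]setTI; last exact: mg.
exact: my.
Qed.

Section iid_uniqueness.
Context {R : realType} {d : nat}.
Notation env := (env R d).

Definition iid_law (nu : probability (pvec R d) R)
    (m : set env -> \bar R) : Prop :=
  forall (l : seq (site d)) (A : site d -> set (pvec R d)),
    uniq l -> (forall s, measurable (A s)) ->
    m [set w : env | forall s, s \in l -> A s (w s)] = (\prod_(s <- l) nu (A s))%E.

Definition rectangle : set (set env) :=
  [set B | exists (l : seq (site d)) (A : site d -> set (pvec R d)),
     [/\ uniq l, forall s, measurable (A s) &
         B = [set w : env | forall s, s \in l -> A s (w s)]]].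

Lemma measurable_rectangle B : rectangle B -> measurable B.
Proof.
move=> [l [A [_ mA ->]]].
rewrite (_ : [set _ | _] = \big[setI/setT]_(s <- l) [set w : env | A s (w s)]).
  apply: bigsetI_measurable => s _; rewrite -[X in measurable X]setTI.
  exact: (@measurable_prod_fun_eval _ _ (pvec R d) s measurableT).
elim: l => [|a l IH]; first by rewrite big_nil; apply/seteqP; split.
rewrite big_cons -IH; apply/seteqP; split => w /=.
  by move=> h; split=> [|s sl]; apply: h; rewrite !inE ?eqxx ?sl ?orbT.
by move=> [h1 h2] s; rewrite inE => /orP[/eqP ->//|]; exact: h2.
Qed.

Lemma rectangle_setI : setI_closed rectangle.
Proof.
move=> _ _ [l [A [ul mA ->]]] [l' [A' [ul' mA' ->]]].
exists (undup (l ++ l')), (fun s => (if s \in l then A s else setT) `&`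
                                    (if s \in l' then A' s else setT)).
split; first exact: undup_uniq.
  by move=> s; apply: measurableI; case: ifP.
apply/seteqP; split => w /=.
  move=> [h h'] s _; split; case: ifP => // sl; [exact: h|exact: h'].
move=> h; split=> s sl; have := h s; rewrite mem_undup mem_cat sl ?orbT => /(_ isT)[];
  by rewrite ?sl.
Qed.

(** Finite rectangles are stable under intersection and generate the product sigma-algebra. Every
    later invariance of [P] is thereby reduced to a check on rectangles. *)
Lemma iid_law_unique (nu : probability (pvec R d) R)
    (m1 m2 : {measure set env -> \bar R}) :
  iid_law nu m1 -> iid_law nu m2 -> forall B, measurable B -> m1 B = m2 B.
Proof.
move=> h1 h2 B mB.
have rT : rectangle setT.
  by exists [::], (fun=> setT); split=> //; apply/seteqP; split.
apply: (measure_unique rectangle (fun=> setT)) => //.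
- apply/seteqP; split; last first.
    apply: smallest_sub; first exact: sigma_algebra_measurable.
    exact: measurable_rectangle.
  apply: smallest_sub; first exact: smallest_sigma_algebra.
  move=> _ [s [A [mA ->]]]; apply: sub_sigma_algebra.
  exists [:: s], (fun=> A); split => //; apply/seteqP; split => w /=.
    by move=> Aw s'; rewrite inE => /eqP ->.
  by apply; rewrite inE.
- exact: rectangle_setI.
- by rewrite bigcup_const//; exists 0%N.
- by move=> _ [l [A [ul mA ->]]]; rewrite h1// h2.
- move=> _; have := h1 [::] (fun=> setT) isT (fun=> measurableT).
  rewrite big_nil (_ : [set w | _] = setT); last by apply/seteqP; split.
  by move=> ->; exact: ltry.
Qed.

End iid_uniqueness.

Section env_maps.
Context {R : realType} {d : nat} (P : probability (env R d) R).
Hypothesis P_iid : iid P.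
Local Open Scope ereal_scope.

Lemma measurable_relabel (g : site d -> site d) :
  measurable_fun setT (fun w : env R d => (w \o g : env R d)).
Proof. by apply: measurable_fun_prod_fun => s; exact: measurable_prod_fun_eval. Qed.

(** Distinct sites stay distinct under an injective [g], so the relabeled environment is again
    i.i.d. with the same marginal. Time shifts and recentering along a fixed path are both of this
    kind. *)
Lemma ge0_integral_relabel (g : site d -> site d) (F : env R d -> \bar R) :
  injective g -> measurable_fun [set: env R d] F -> (forall w, 0 <= F w) ->
  \int[P]_w F (w \o g) = \int[P]_w F w.
Proof.
move=> ginj mF F0.
pose phi (w : env R d) : env R d := w \o g.
have mphi : measurable_fun setT phi by exact: measurable_relabel.
have [nu hnu] := P_iid.
rewrite -[LHS](@ge0_integral_pushforward _ _ _ _ _ phi mphi P setT F)//.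
apply: (@eq_measure_integral _ _ _ _ P
  (measure_function_pushforward__canonical__measure_function_Measure P mphi)) => B mB _.
apply: (@iid_law_unique R d nu) => // l A ul mA.
rewrite /= /pushforward /=.
(* The constraint at [s] is moved to the site [g s]; sites off the range of [g] are left
   unconstrained. *)
pose A' s := if pselect (exists s', s = g s') is left e then A (projT1 (cid e)) else setT.
have A'E s : A' (g s) = A s.
  rewrite /A'; case: pselect => [e|[]]; last by exists s.
  by case: cid => s' /= /ginj <-.
have -> : phi @^-1` [set w : env R d | forall s, s \in l -> A s (w s)] =
    [set w : env R d | forall s, s \in map g l -> A' s (w s)].
  apply/seteqP; split => w /=.
    by move=> h _ /mapP[s sl ->]; rewrite A'E; exact: h.
  by move=> h s sl; have := h (g s) (map_f _ sl); rewrite A'E.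
apply: etrans (hnu (map g l) A' _ _) _; first by rewrite map_inj_uniq.
  by move=> s; rewrite /A'; case: pselect.
by rewrite big_map; apply: eq_bigr => s _; rewrite A'E.
Qed.

Definition glue (a : int) (w w' : env R d) : env R d :=
  fun s => if (s.1 < a)%R then w s else w' s.

Lemma measurable_glue a :
  measurable_fun setT (fun w : env R d * env R d => glue a w.1 w.2).
Proof.
apply: measurable_fun_prod_fun => s; rewrite /glue.
case: (s.1 < a)%R.
  exact: (measurableT_comp (measurable_prod_fun_eval (T := pvec R d) s) measurable_fst).
exact: (measurableT_comp (measurable_prod_fun_eval (T := pvec R d) s) measurable_snd).
Qed.

(* Regluing two independent environments along a time level again gives [P],
   which decouples the two factors. *)
Lemma ge0_integralM_levels (a : int) (F G : env R d -> \bar R) :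
  measurable_fun [set: env R d] F -> measurable_fun [set: env R d] G ->
  (forall w, 0 <= F w) -> (forall w, 0 <= G w) ->
  (forall w w', (forall s, (s.1 < a)%R -> w s = w' s) -> F w = F w') ->
  (forall w w', (forall s, (a <= s.1)%R -> w s = w' s) -> G w = G w') ->
  \int[P]_w (F w * G w) = \int[P]_w F w * \int[P]_w G w.
Proof.
move=> mF mG F0 G0 locF locG.
pose phi (w : env R d * env R d) : env R d := glue a w.1 w.2.
have mphi : measurable_fun setT phi by exact: measurable_glue.
have [nu hnu] := P_iid.
pose PP : {measure set _ -> \bar R} :=
  measure_function_pushforward__canonical__measure_function_Measure (P \x P) mphi.
transitivity (\int[PP]_w (F w * G w)).
  apply: eq_measure_integral => B mB _.
  apply: (@iid_law_unique R d nu) => // l A ul mA.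
  rewrite /PP /= /pushforward /=.
  (* Each constraint goes to the factor that supplies its level; the other factor gets [setT], of
     [nu]-mass 1, so the two products recombine. *)
  pose A1 s := if (s.1 < a)%R then A s else setT.
  pose A2 s := if (s.1 < a)%R then setT else A s.
  pose B1 := [set w : env R d | forall s, s \in l -> A1 s (w s)].
  pose B2 := [set w : env R d | forall s, s \in l -> A2 s (w s)].
  have mA1 s : measurable (A1 s) by rewrite /A1; case: ifP.
  have mA2 s : measurable (A2 s) by rewrite /A2; case: ifP.
  have -> : phi @^-1` [set w : env R d | forall s, s \in l -> A s (w s)] = B1 `*` B2.
    apply/seteqP; split => -[w w'] /=; rewrite /phi /glue /B1 /B2 /A1 /A2 /=.
      by move=> h; split=> s sl; have := h s sl; case: ifP.
    by move=> [h1 h2] s sl; have := h1 s sl; have := h2 s sl; case: ifP.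
  rewrite product_measure1E; last 2 first.
  - by apply: measurable_rectangle; exists l, A1.
  - by apply: measurable_rectangle; exists l, A2.
  rewrite [X in X * _](hnu l A1)// [X in _ * X](hnu l A2)// -big_split /=.
  apply: eq_bigr => s _; rewrite /A1 /A2; case: ifP => _.
    by rewrite probability_setT mule1.
  by rewrite probability_setT mul1e.
rewrite [LHS](@ge0_integral_pushforward _ _ _ _ _ phi mphi (P \x P))//; last 2 first.
- exact: emeasurable_funM.
- by move=> w _; rewrite mule_ge0.
rewrite preimage_setT -[LHS]/(\int[P \x P]_w (F (phi w) * G (phi w))).
transitivity (\int[P \x P]_w (F w.1 * G w.2)).
  apply: eq_integral => -[w w'] _; rewrite /phi /=; congr (_ * _).
    by apply: locF => s sa; rewrite /glue sa.
  by apply: locG => s sa; rewrite /glue ltNge sa.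
rewrite fubini_tonelli1; last 2 first.
- by apply: emeasurable_funM; exact: measurableT_comp.
- by move=> w; rewrite mule_ge0.
rewrite /fubini_F /=.
under eq_integral do rewrite ge0_integralZl//.
by rewrite ge0_integralZr// integral_ge0.
Qed.

End env_maps.

(** * Integration against a semidirect product *)

Section semidirect_integral.
Context {R : realType} {d1 d2 : measure_display}
  {T1 : measurableType d1} {T2 : measurableType d2}.
Variables (P : probability T1 R) (Q : R.-pker T1 ~> T2).
Local Open Scope ereal_scope.

Let integral_indic_semidirect E : measurable E ->
  \int[semidirect P Q]_p (\1_E p)%:E = \int[P]_x \int[Q x]_y (\1_E (x, y))%:E.
Proof.
move=> mE; rewrite integral_indic// setIT /=.
by apply: eq_integral => x _; rewrite -[RHS]/(kfcomp Q (EFin \o \1_E) x) kfcompkindic.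
Qed.

Import HBNNSimple.

Let integral_nnsfun_semidirect (f : {nnsfun T1 * T2 >-> R}) :
  \int[semidirect P Q]_p (f p)%:E = \int[P]_x \int[Q x]_y (f (x, y))%:E.
Proof.
have mf r : measurable (f @^-1` [set r]) by [].
(* The summation lemmas ask for side conditions at every real [r]. For negative [r] the level set of
   the nonnegative [f] is empty and the term vanishes. *)
have h0 r p : (r < 0 -> r * \1_(f @^-1` [set r]) p = 0)%R.
  move=> r0; rewrite indicE; case: (boolP (p \in _)) => [|_]; last by rewrite mulr0.
  by rewrite inE /= => fr; have : (0 <= f p)%R by []; rewrite fr leNgt r0.
have mI r : measurable_fun setT (fun p => (r * \1_(f @^-1` [set r]) p)%:E : \bar R).
  by apply/measurable_EFinP; apply: measurable_funM.
have mI2 r x : measurable_fun setT (fun y => (r * \1_(f @^-1` [set r]) (x, y))%:E : \bar R).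
  exact: measurableT_comp (mI r) (measurable_pair1 x).
under [in LHS]eq_integral do rewrite fimfunE -fsumEFin//.
rewrite ge0_integral_fsum//; last by move=> r z _; rewrite EFinM nnfun_muleindic_ge0.
under [in RHS]eq_integral.
  move=> x _.
  under eq_integral do rewrite fimfunE -fsumEFin//.
  rewrite ge0_integral_fsum//; last by move=> r z _; rewrite EFinM nnfun_muleindic_ge0.
  over.
rewrite /= ge0_integral_fsum//; last 2 first.
- move=> r.
  have [r0|r0] := leP 0%R r; last first.
    rewrite (_ : (fun _ => _) = cst 0) //.
    by apply/funext => x; rewrite integral0_eq// => y _; rewrite h0.
  apply: (measurable_fun_integral_finite_kernel (fun p => (r * \1_(f @^-1` [set r]) p)%:E) Q) => //.
  by move=> z; rewrite EFinM nnfun_muleindic_ge0.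
- by move=> r x _; apply: integral_ge0 => y _; rewrite EFinM nnfun_muleindic_ge0.
apply: eq_fsbigr => r _.
have [r0|r0] := leP 0%R r; last first.
  rewrite [LHS]integral0_eq; last by move=> p _ /=; rewrite h0.
  by rewrite integral0_eq// => x _; rewrite integral0_eq// => y _; rewrite h0.
transitivity (\int[semidirect P Q]_p (r%:E * (\1_(f @^-1` [set r]) p)%:E)) => //.
rewrite ge0_integralZl//; last by apply/measurable_EFinP; apply: measurable_indic.
rewrite integral_indic_semidirect//.
rewrite -ge0_integralZl//; last 2 first.
- apply: (measurable_fun_integral_finite_kernel (fun p => (\1_(f @^-1` [set r]) p)%:E) Q) => //.
  by apply/measurable_EFinP; apply: measurable_indic.
- by move=> x _; apply: integral_ge0 => y _; rewrite lee_fin.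
apply: eq_integral => x _; rewrite -ge0_integralZl//.
have m1 : measurable_fun setT (EFin \o \1_(f @^-1` [set r]) : T1 * T2 -> \bar R).
  by apply/measurable_EFinP; apply: measurable_indic.
exact: (measurableT_comp m1 (measurable_pair1 x)).
Qed.

Lemma ge0_integral_semidirect (f : T1 * T2 -> \bar R) :
  measurable_fun setT f -> (forall p, 0 <= f p) ->
  \int[semidirect P Q]_p f p = \int[P]_x \int[Q x]_y f (x, y).
Proof.
move=> mf f0.
pose f_ := nnsfun_approx measurableT mf.
have mf_ n : measurable_fun setT (fun p => (f_ n p)%:E).
  exact/measurable_EFinP.
have mf_2 n x : measurable_fun setT (fun y => (f_ n (x, y))%:E).
  exact: measurableT_comp (mf_ n) (measurable_pair1 x).
have ndf x y : {homo (fun n => (f_ n (x, y))%:E) : a b / (a <= b)%N >-> a <= b}.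
  by move=> a b ab; rewrite lee_fin; exact/lefP/nd_nnsfun_approx.
transitivity (\int[semidirect P Q]_p (lim ((f_ n p)%:E @[n --> \oo]))).
  by apply/eq_integral => z _; apply/esym/cvg_lim => //=; exact: cvg_nnsfun_approx.
rewrite monotone_convergence//; last 2 first.
  by move=> n z _; rewrite lee_fin.
  by move=> [x y] _; exact: ndf.
rewrite (_ : (fun _ => _) =
    (fun n => \int[P]_x (\int[Q x]_y (f_ n (x, y))%:E)))//; last first.
  by apply/funext => n; rewrite integral_nnsfun_semidirect.
transitivity (\int[P]_x lim ((\int[Q x]_y (f_ n (x, y))%:E) @[n --> \oo])).
  rewrite -monotone_convergence//.
  - move=> n; apply: (measurable_fun_integral_finite_kernel (fun p => (f_ n p)%:E) Q) => //.
    by move=> z; rewrite lee_fin.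
  - by move=> n y _; apply: integral_ge0 => // z _; rewrite lee_fin.
  - move=> x _ a b ab; apply: ge0_le_integral => //.
    + by move=> z _; rewrite lee_fin.
    + by move=> z _; exact: ndf.
apply: eq_integral => x _; rewrite -monotone_convergence//.
- by apply: eq_integral => z _; apply/cvg_lim => //; exact: cvg_nnsfun_approx.
- by move=> n z _; rewrite lee_fin.
Qed.

End semidirect_integral.

(** * Nearest-neighbor paths *)

Section paths.
Context {R : realType} {d : nat}.
Notation lattice := (lattice d).

(** An integer vector of Euclidean norm 1 has coordinates in {-1, 0, 1}; [h] parametrizes all such
    vectors by functions into ['I_3], shifted by 1. *)
Lemma finite_sphere : finite_set [set z : lattice | on_sphere R z].
Proof.
pose h (g : {ffun 'I_d.+1 -> 'I_3}) : lattice := \row_i ((g i)%:Z - 1).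
apply: (@sub_finite_set _ _ (range h)); last exact: finite_image.
move=> z /=; rewrite /on_sphere /= /enorm => /eqP z1.
have dz : dot (embed R z) (embed R z) = 1.
  have /sqr_sqrtr <- : 0 <= dot (embed R z) (embed R z).
    by apply: sumr_ge0 => i _; rewrite -expr2 sqr_ge0.
  by rewrite z1 expr1n.
have zi i : (z 0 i) ^+ 2 <= 1.
  have : (z 0 i)%:~R ^+ 2 <= dot (embed R z) (embed R z).
    rewrite /dot (bigD1 i)//= !mxE -expr2 lerDl.
    by apply: sumr_ge0 => j _; rewrite -expr2 sqr_ge0.
  by rewrite dz -rmorphXn -[X in _ <= X](rmorph1 (intmul (1 : R))) ler_int.
exists [ffun i => inord (absz (z 0 i + 1))] => //.
apply/rowP => i; rewrite !mxE ffunE.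
have /andP[z0 z2] : -1 <= z 0 i <= 1 by apply/andP; have := zi i; split; nia.
rewrite inordK ?gez0_abs ?addrK//; first by lia.
by rewrite -ltz_nat gez0_abs; lia.
Qed.

Definition sphere : seq lattice :=
  finmap.enum_fset (fset_set [set z : lattice | on_sphere R z]).

Lemma mem_sphere z : (z \in sphere) = on_sphere R z.
Proof.
rewrite [LHS](in_fset_set finite_sphere).
by apply/idP/idP => [|h]; rewrite inE.
Qed.

Lemma sphere_uniq : uniq sphere.
Proof. exact: finmap.fset_uniq. Qed.

Fixpoint paths (n : nat) : seq (seq lattice) :=
  if n is n'.+1 then [seq z :: s | z <- sphere, s <- paths n'] else [:: [::]].

Lemma mem_paths n s : (s \in paths n) = (size s == n) && all (mem sphere) s.
Proof.
elim: n s => [|n IH] [|z s] //=.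
  by apply/allpairsP => -[[z s] []].
rewrite eqSS andbCA -IH.
apply/allpairsP/andP => [[[z' s'] /= [h1 h2 [-> ->]]]//|[h1 h2]].
by exists (z, s).
Qed.

Lemma paths_uniq n : uniq (paths n).
Proof.
elim: n => [|n IH] //=; apply: allpairs_uniq => //; first exact: sphere_uniq.
by move=> [? ?] [? ?] _ _ [-> ->].
Qed.

Lemma size_paths n s : s \in paths n -> size s = n.
Proof. by rewrite mem_paths => /andP[/eqP]. Qed.

Lemma big_paths_cat (V : nmodType) a b (F : seq lattice -> V) :
  \sum_(s <- paths (a + b)) F s =
  \sum_(s <- paths a) \sum_(s' <- paths b) F (s ++ s').
Proof.
elim: a F => [|a IH] F; first by rewrite big_seq1.
rewrite !big_allpairs_dep; apply: eq_bigr => z _ /=.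
by rewrite IH.
Qed.

Definition path_of (s : seq lattice) : traj d := fun i => \sum_(k < i) s`_k.

Lemma path_of0 s : path_of s 0%N = 0.
Proof. by rewrite /path_of big_ord0. Qed.

Lemma path_ofS s i : path_of s i.+1 = path_of s i + s`_i.
Proof. by rewrite /path_of big_ord_recr. Qed.

Lemma path_of_cons z s i : path_of (z :: s) i.+1 = z + path_of s i.
Proof. by rewrite /path_of big_ord_recl. Qed.

Lemma path_of_drop s j k : path_of (drop j s) k = path_of s (j + k)%N - path_of s j.
Proof.
elim: k => [|k IH]; first by rewrite addn0 subrr path_of0.
by rewrite addnS !path_ofS IH nth_drop addrAC.
Qed.

Lemma path_of_take s n k : (k <= n)%N -> path_of (take n s) k = path_of s k.
Proof.
elim: k => [|k IH] kn; first by rewrite !path_of0.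
by rewrite !path_ofS IH ?nth_take// ltnW.
Qed.

End paths.

(** * Quenched law of the walk *)

Section observables.
Context {R : realType} {d : nat}.

Lemma measurable_fun_lattice (disp : measure_display) (S : measurableType disp)
  (h : lattice d -> S) : measurable_fun setT h.
Proof. by []. Qed.

Lemma measurable_traj_eval (i : nat) :
  measurable_fun setT (fun p : env R d * traj d => p.2 i).
Proof.
exact: (measurableT_comp (measurable_prod_fun_eval (T := lattice d) i) measurable_snd).
Qed.

Lemma measurable_seen_from (m : int) (j : nat) :
  measurable_fun setT (fun p : env R d * traj d => shift_env m (p.2 j) p.1).
Proof.
apply: measurable_fun_prod_fun => s; rewrite /shift_env.
apply: (@measurable_fun_lattice_index _ _ d _ _ (fun p : env R d * traj d => p.2 j)
  (fun z p => p.1 (s.1 + m, s.2 + z))); first exact: measurable_traj_eval.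
move=> z.
exact: (measurableT_comp (measurable_prod_fun_eval (T := pvec R d) _) measurable_fst).
Qed.

Lemma measurable_steps_after (j : nat) :
  measurable_fun setT (fun p : env R d * traj d => steps_after R j p.2 : steps R d).
Proof.
apply: measurable_fun_prod_fun => i; rewrite /steps_after.
apply: (@measurable_fun_lattice_index _ _ d _ _ (fun p : env R d * traj d => p.2 (j + i)%N)
  (fun z p => insubd (point : unit_step R d) (p.2 (j + i).+1 - z))).
  exact: measurable_traj_eval.
move=> z.
exact: (measurableT_comp (measurable_fun_lattice
  (fun y => insubd (point : unit_step R d) (y - z))) (measurable_traj_eval _)).
Qed.

Lemma measurable_observable_at (f : env R d * steps R d -> R) (m : int) (j : nat) :
  measurable_fun setT f ->
  measurable_fun setT (fun p : env R d * traj d =>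
    f (shift_env m (p.2 j) p.1, steps_after R j p.2)).
Proof.
move=> mf; apply: (measurableT_comp mf).
apply/measurable_fun_pairP; split.
  exact: measurable_seen_from.
exact: measurable_steps_after.
Qed.

End observables.

Section quenched.
Context {R : realType} {d : nat}.
Variables (P : probability (env R d) R) (Q : R.-pker (env R d) ~> traj d).
Hypotheses (P_iid : iid P) (P_nn : nearest_neighbor P) (Q_law : quenched_law Q).
Notation sphere := (@sphere R d).
Notation paths := (@paths R d).
Local Open Scope ereal_scope.

Definition path_weight (w : env R d) (s : seq (lattice d)) : R :=
  (\prod_(i < size s) w (i%:Z, path_of s i) s`_i)%R.

Lemma path_weight_ge0 w s : (0 <= path_weight w s)%R.
Proof. by apply: prodr_ge0 => i _; exact: pv_ge0. Qed.

(** Markov property: after a first step [z], the walk runs in the environment seen from [(1, z)]. *)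
Lemma path_weight_cons w z s :
  path_weight w (z :: s) = (w (0, 0) z * path_weight (shift_env 1 z w) s)%R.
Proof.
rewrite /path_weight /= big_ord_recl /= path_of0; congr (_ * _)%R.
apply: eq_bigr => i _; rewrite /bump /= add1n /= path_of_cons /shift_env /=.
by rewrite addrC [(_ + 1)%R]addrC -intS.
Qed.

(** The environments for which the nearest-neighbor paths of a given length carry all the quenched
    mass. *)
Definition conservative (w : env R d) : Prop :=
  forall s, (\sum_(z <- sphere) w s z = 1)%R.

Lemma sum_path_weight w n : conservative w -> (\sum_(s <- paths n) path_weight w s = 1)%R.
Proof.
elim: n w => [|n IH] w cw; first by rewrite big_seq1 /path_weight big_ord0.
rewrite big_allpairs_dep -[RHS](cw (0, 0)%R); apply: eq_bigr => z _.
under eq_bigr do rewrite path_weight_cons.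
by rewrite -big_distrr /= IH ?mulr1// => s; exact: cw.
Qed.

(** The bad environments lie in a countable union, over sites and steps off the sphere, of events
    that are null at the origin by [P_nn] and at every other site by equality of the marginals.
    [pickle] enumerates the pairs. *)
Lemma ae_conservative : {ae P, forall w, conservative w}.
Proof.
pose T := (int * 'rV[int]_d.+1 * 'rV[int]_d.+1)%type.
pose N (k : nat) : set (env R d) := if (unpickle k : option T) is Some (s, z) then
  (if on_sphere R (z : lattice d) then set0 else [set w : env R d | (0 < w s z)%R]) else set0.
apply: (@negligibleS _ _ _ _ (\bigcup_k N k)); last first.
  apply: negligible_bigcup => k; rewrite /N; case: (unpickle k : option T) => [[s z]|];
    last exact: negligible_set0.
  case: ifPn => zS; first exact: negligible_set0.
  have [nu hnu] := P_iid.
  have m0 : measurable [set p : pvec R d | (0 < p z)%R].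
    rewrite -[X in measurable X]setTI.
    rewrite (_ : [set _ | _] = (fun p : pvec R d => p z) @^-1` `]0%R, +oo[%classic).
      exact: (measurable_pvec_eval z measurableT (measurable_itv `]0%R, +oo[)).
    by apply/seteqP; split => p /=; rewrite in_itv /= andbT.
  have hs s' : P [set w : env R d | (0 < w s' z)%R] = nu [set p : pvec R d | (0 < p z)%R].
    have := hnu [:: s'] (fun=> [set p : pvec R d | (0 < p z)%R]) isT (fun=> m0).
    rewrite big_seq1 => <-; congr (P _); apply/seteqP; split => w /=.
      by move=> ? s''; rewrite inE => /eqP ->.
    by apply; rewrite inE.
  exists [set w : env R d | (0 < w s z)%R]; split => //.
    rewrite -[X in measurable X]setTI.
    rewrite (_ : [set _ | _] = (fun w : env R d => w s z) @^-1` `]0%R, +oo[%classic).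
      exact: (measurable_env_eval s z measurableT (measurable_itv `]0%R, +oo[)).
    by apply/seteqP; split => w /=; rewrite in_itv /= andbT.
  by rewrite [LHS]hs -(hs (0, 0)%R) P_nn.
move=> w /= /existsNP[s ws]; apply: contrapT => nN; apply: ws.
have w0 z : ~~ on_sphere R z -> w s z = 0%R.
  move=> zS; apply/eqP; rewrite eq_le pv_ge0 andbT leNgt; apply/negP => wz.
  have [k kE] : exists k, unpickle k = Some ((s, z) : T).
    by exists (pickle ((s, z) : T)); exact: pickleK.
  by apply: nN; exists k => //; rewrite /N kE (negbTE zS).
have := pv_sum1 (w s); rewrite (esumID [set z | on_sphere R z]); last first.
  by move=> z _; rewrite lee_fin pv_ge0.
rewrite !setTI [X in _ + X]esum1 ?adde0; last first.
  by move=> z /= /negP zS; rewrite w0.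
rewrite esum_fset; [|exact: finite_sphere|by move=> z _; rewrite lee_fin pv_ge0].
by rewrite fsbig_finite ?sumEFin; [move=> -[]|exact: finite_sphere].
Qed.

Definition path_cylinder (s : seq (lattice d)) : set (traj d) :=
  [set X | forall i, (i <= size s)%N -> X i = path_of s i].

Lemma measurable_path_cylinder s : measurable (path_cylinder s).
Proof.
rewrite (_ : path_cylinder s =
    \big[setI/setT]_(i < (size s).+1) [set X : traj d | X i = path_of s i]).
  apply: bigsetI_measurable => i _; rewrite -[X in measurable X]setTI.
  exact: (@measurable_prod_fun_eval _ nat (lattice d) i measurableT [set path_of s i]).
rewrite -(bigcap_mkord _ (fun i => [set X : traj d | X i = path_of s i])).
by apply/seteqP; split => X /= h i; exact: h.
Qed.

Lemma quenched_path_cylinder w s : Q w (path_cylinder s) = (path_weight w s)%:E.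
Proof.
rewrite [LHS](Q_law w (size s) (path_of0 s)); congr (_%:E).
by apply: eq_bigr => i _; rewrite path_ofS addrC addKr.
Qed.

Lemma trivIset_path_cylinder n : trivIset [set` paths n] path_cylinder.
Proof.
move=> s s' /= /size_paths ss /size_paths ss' [X [Xs Xs']].
apply: (@eq_from_nth _ 0%R) => [|i si]; first by rewrite ss ss'.
have stepE t : path_cylinder t X -> (i < size t)%N -> t`_i = (X i.+1 - X i)%R.
  by move=> Xt it; rewrite !Xt ?(ltnW it)// path_ofS addrC addKr.
by rewrite !stepE// ss' -ss.
Qed.

(** The cylinders of the paths of length [n] are disjoint, have total mass 1 and make [F] constant
    on each. *)
Lemma ge0_integral_quenched w n (F : traj d -> \bar R) :
  conservative w -> measurable_fun [set: traj d] F -> (forall X, 0 <= F X) ->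
  (forall X X', (forall i, (i <= n)%N -> X i = X' i) -> F X = F X') ->
  \int[Q w]_X F X = \sum_(s <- paths n) F (path_of s) * (path_weight w s)%:E.
Proof.
move=> cw mF F0 locF.
pose G := \big[setU/set0]_(s <- paths n) path_cylinder s.
have mG : measurable G by apply: bigsetU_measurable => s _; exact: measurable_path_cylinder.
have intG (H : traj d -> \bar R) : measurable_fun [set: traj d] H -> (forall X, 0 <= H X) ->
    \int[Q w]_(X in G) H X = \sum_(s <- paths n) \int[Q w]_(X in path_cylinder s) H X.
  move=> mH H0; apply: ge0_integral_bigsetU => //.
  - exact: measurable_path_cylinder.
  - exact: paths_uniq.
  - exact: trivIset_path_cylinder.
  - exact: measurable_funTS.
have QG : Q w G = 1.
  rewrite -[LHS]mul1e -integral_cst// intG//.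
  rewrite -[RHS](congr1 EFin (sum_path_weight n cw)) -sumEFin; apply: eq_bigr => s _.
  by rewrite integral_cst ?mul1e ?quenched_path_cylinder//; exact: measurable_path_cylinder.
have QGC : Q w (~` G) = 0.
  have : Q w G + Q w (~` G) = 1.
    rewrite -measureU//; [|exact: measurableC|exact: setICr].
    by rewrite setUv; exact: prob_kernel.
  rewrite QG; case: (Q w (~` G)) => [r||]//= [] /(canRL (addKr _)) ->.
  by rewrite addNr.
rewrite (@ge0_negligible_integral _ _ _ (Q w) setT (~` G))//; last exact: measurableC.
rewrite setTD setCK intG//; apply: eq_big_seq => s sn.
rewrite -quenched_path_cylinder -integral_cst; last exact: measurable_path_cylinder.
apply: eq_integral => X; rewrite inE => Xs; apply: locF => i; rewrite -(size_paths sn).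
exact: Xs.
Qed.

End quenched.

(** * The recentered environment *)

Section averaged_walk.
Context {R : realType} {d : nat}.
Variables (P : probability (env R d) R) (Q : R.-pker (env R d) ~> traj d).
Hypotheses (P_iid : iid P) (P_nn : nearest_neighbor P) (Q_law : quenched_law Q).
Notation sphere := (@sphere R d).
Notation paths := (@paths R d).
Local Open Scope ereal_scope.

Lemma measurable_path_weight s :
  measurable_fun [set: env R d] (fun w : env R d => path_weight w s).
Proof.
apply: measurable_prod => i _; exact: measurable_env_eval.
Qed.

Lemma ge0_integral_walk n (F : env R d * traj d -> R) :
  measurable_fun setT F -> (forall p, (0 <= F p)%R) ->
  (forall w X X', (forall i, (i <= n)%N -> X i = X' i) -> F (w, X) = F (w, X')) ->
  \int[semidirect P Q]_p (F p)%:E =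
  \sum_(s <- paths n) \int[P]_w (F (w, path_of s) * path_weight w s)%:E.
Proof.
move=> mF F0 locF.
have mF' : measurable_fun setT (EFin \o F) by exact/measurable_EFinP.
have mFs s : measurable_fun [set: env R d]
    (fun w : env R d => (F (w, path_of s) * path_weight w s)%:E).
  apply/measurable_EFinP; apply: measurable_funM; last exact: measurable_path_weight.
  exact: (measurableT_comp mF (measurable_pair2 (path_of s))).
have F0s s w : 0 <= (F (w, path_of s) * path_weight w s)%:E.
  by rewrite lee_fin mulr_ge0// path_weight_ge0.
rewrite ge0_integral_semidirect//.
rewrite -ge0_integral_sum//.
apply: ge0_ae_eq_integral => //.
- apply: (measurable_fun_integral_finite_kernel (EFin \o F) Q) => //.
- exact: emeasurable_sum.
- by move=> w _; apply: integral_ge0 => X _; rewrite lee_fin.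
- by move=> w _; apply: sume_ge0 => s _.
apply: filterS (ae_conservative P_iid P_nn) => w cw _.
rewrite (@ge0_integral_quenched _ _ Q Q_law w n (fun X => (F (w, X))%:E))//.
- exact: (measurableT_comp mF' (measurable_pair1 w)).
- by move=> X; rewrite lee_fin.
- by move=> X X' /locF ->.
Qed.

(* Recentering each time level at the position of the path turns the
   environment along the path into an i.i.d. column at the origin. *)
Definition recenter (s : seq (lattice d)) (w : env R d) : env R d :=
  fun x => w (x.1, x.2 - if x.1 is Posz k then path_of s k else 0)%R.

Definition column_weight (w : env R d) (s : seq (lattice d)) : R :=
  (\prod_(i < size s) w (i%:Z, 0) s`_i)%R.

Lemma column_weight_ge0 w s : (0 <= column_weight w s)%R.
Proof. by apply: prodr_ge0 => i _; exact: pv_ge0. Qed.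

Lemma path_weight_recenter s w : path_weight (recenter s w) s = column_weight w s.
Proof. by apply: eq_bigr => i _; rewrite /recenter /= subrr. Qed.

Lemma measurable_recenter s : measurable_fun setT (recenter s).
Proof. exact: (measurable_relabel (fun x => (x.1, x.2 - _)%R)). Qed.

Lemma measurable_column_weight s :
  measurable_fun [set: env R d] (fun w : env R d => column_weight w s).
Proof. apply: measurable_prod => i _; exact: measurable_env_eval. Qed.

Lemma column_weight_cat w s s' :
  column_weight w (s ++ s') =
  (column_weight w s * column_weight (shift_env (size s)%:Z 0 w) s')%R.
Proof.
rewrite /column_weight size_cat big_split_ord /=; congr (_ * _)%R.
  by apply: eq_bigr => i _; rewrite nth_cat ltn_ord.
apply: eq_bigr => i _; rewrite nth_cat ltnNge leq_addr /= addKn /shift_env /= addr0.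
by rewrite PoszD addrC.
Qed.

(* The averaged law of the recentered environment and of the first n steps,
   with each step z weighted by t z. *)
Definition tilted (t : lattice d -> R) (n : nat) (F : env R d -> seq (lattice d) -> R) : \bar R :=
  \sum_(s <- paths n) \int[P]_w (F w s * (column_weight w s * \prod_(z <- s) t z))%:E.

(** Once the path [s] is frozen, [recenter s] is an injective relabeling of sites, hence preserves
    [P], and it turns the path weight into a column weight. Randomness of the path does no harm
    because the sum over paths stands outside the integral. *)
Lemma walk_tilted n (F : env R d * traj d -> R) :
  measurable_fun setT F -> (forall p, (0 <= F p)%R) ->
  (forall w X X', (forall i, (i <= n)%N -> X i = X' i) -> F (w, X) = F (w, X')) ->
  \int[semidirect P Q]_p (F p)%:E =
  tilted (fun=> 1%R) n (fun w s => F (recenter s w, path_of s)).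
Proof.
move=> mF F0 locF; rewrite (ge0_integral_walk mF F0 locF).
apply: eq_bigr => s _.
under [RHS]eq_integral do rewrite big1_eq mulr1 -path_weight_recenter.
pose g (x : site d) : site d := (x.1, x.2 - if x.1 is Posz k then path_of s k else 0)%R.
rewrite -(@ge0_integral_relabel _ _ _ P_iid g)//.
- move=> [i y] [i' y'] [ii']; subst i'.
  by move=> /addIr ->.
- apply/measurable_EFinP; apply: measurable_funM; last exact: measurable_path_weight.
  exact: (measurableT_comp mF (measurable_pair2 (path_of s))).
- by move=> w; rewrite lee_fin mulr_ge0// path_weight_ge0.
Qed.

End averaged_walk.

Lemma pv_le1 (R : realType) (d : nat) (p : pvec R d) z : p z <= 1.
Proof.
have := pv_sum1 p; rewrite (esumID [set z]); last by move=> y _; rewrite lee_fin pv_ge0.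
rewrite !setTI esum_set1 ?lee_fin ?pv_ge0// => pE.
rewrite -lee_fin -pE leeDl// esum_ge0// => y _.
by rewrite lee_fin pv_ge0.
Qed.

(** * Calculus of the tilted functional: linearity, factorization, total mass *)

Section tilted.
Context {R : realType} {d : nat}.
Variables (P : probability (env R d) R).
Hypotheses (P_iid : iid P).
Notation sphere := (@sphere R d).
Notation paths := (@paths R d).
Notation functional := (env R d -> seq (lattice d) -> R).
Local Open Scope ereal_scope.

Definition path_measurable (F : functional) : Prop :=
  forall s, measurable_fun [set: env R d] (fun w : env R d => F w s).

Definition local_levels (a : nat) (F : functional) : Prop :=
  forall w w' s, (forall x : site d, (0 <= x.1 < a%:Z)%R -> w x = w' x) -> F w s = F w' s.

Variable t : lattice d -> R.
Hypothesis t0 : forall z, (0 <= t z)%R.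

Lemma step_prod_ge0 s : (0 <= \prod_(z <- s) t z)%R.
Proof. exact: prodr_ge0. Qed.

Lemma measurable_tilted_integrand (F : functional) s : path_measurable F ->
  measurable_fun [set: env R d]
    (fun w : env R d => (F w s * (column_weight w s * \prod_(z <- s) t z))%:E).
Proof.
move=> mF; apply/measurable_EFinP; apply: measurable_funM; first exact: mF.
by apply: measurable_funM => //; exact: measurable_column_weight.
Qed.

Lemma tilted_integrand_ge0 (F : functional) s w : (forall w s, 0 <= F w s)%R ->
  0 <= (F w s * (column_weight w s * \prod_(z <- s) t z))%:E.
Proof. by move=> F0; rewrite lee_fin !mulr_ge0 ?column_weight_ge0 ?step_prod_ge0. Qed.

Lemma tilted_ge0 n (F : functional) : (forall w s, 0 <= F w s)%R -> 0 <= tilted P t n F.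
Proof.
move=> F0; apply: sume_ge0 => s _; apply: integral_ge0 => w _.
exact: tilted_integrand_ge0.
Qed.

Lemma tilted_sum (I : Type) (r : seq I) n (F : I -> functional) :
  (forall i, path_measurable (F i)) -> (forall i w s, 0 <= F i w s)%R ->
  tilted P t n (fun w s => \sum_(i <- r) F i w s)%R = \sum_(i <- r) tilted P t n (F i).
Proof.
move=> mF F0; rewrite exchange_big /=; apply: eq_bigr => s _.
under eq_integral do rewrite big_distrl /= -sumEFin.
rewrite ge0_integral_sum//.
- by move=> i; exact: measurable_tilted_integrand.
- by move=> i w _; exact: tilted_integrand_ge0.
Qed.

Lemma tiltedD n (F G : functional) :
  path_measurable F -> path_measurable G ->
  (forall w s, 0 <= F w s)%R -> (forall w s, 0 <= G w s)%R ->
  tilted P t n (fun w s => F w s + G w s)%R = tilted P t n F + tilted P t n G.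
Proof.
move=> mF mG F0 G0; rewrite -big_split /=; apply: eq_bigr => s _.
under eq_integral do rewrite mulrDl EFinD.
rewrite ge0_integralD//; try exact: measurable_tilted_integrand.
- by move=> w _; exact: tilted_integrand_ge0.
- by move=> w _; exact: tilted_integrand_ge0.
Qed.

Lemma tiltedZ n (c : R) (F : functional) : (0 <= c)%R ->
  path_measurable F -> (forall w s, 0 <= F w s)%R ->
  tilted P t n (fun w s => c * F w s)%R = c%:E * tilted P t n F.
Proof.
move=> c0 mF F0; rewrite ge0_sume_distrr; last first.
  by move=> s _; apply: integral_ge0 => w _; exact: tilted_integrand_ge0.
apply: eq_bigr => s _; rewrite -ge0_integralZl//.
- by apply: eq_integral => w _; rewrite -mulrA EFinM.
- exact: measurable_tilted_integrand.
- by move=> w _; exact: tilted_integrand_ge0.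
Qed.

(** This is the independence of the pairs (level, step): for fixed paths, [F] and its weights read
    levels below [a], while [G] and its weights read levels from [a] on, so [ge0_integralM_levels]
    factorizes the integral and time-shift invariance brings the second factor back to level 0. *)
Lemma tilted_cat a b (F G : functional) :
  path_measurable F -> path_measurable G ->
  (forall w s, 0 <= F w s)%R -> (forall w s, 0 <= G w s)%R ->
  local_levels a F -> local_levels b G ->
  tilted P t (a + b) (fun w s => F w (take a s) * G (shift_env a%:Z 0 w) (drop a s))%R =
  tilted P t a F * tilted P t b G.
Proof.
move=> mF mG F0 G0 lF lG.
rewrite {1}/tilted big_paths_cat ge0_sume_distrl; last first.
  by move=> s _; apply: integral_ge0 => w _; exact: tilted_integrand_ge0.
apply: eq_big_seq => s /size_paths sa.
rewrite ge0_sume_distrr; last first.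
  by move=> s' _; apply: integral_ge0 => w _; exact: tilted_integrand_ge0.
apply: eq_big_seq => s' /size_paths sb.
(* The summand 0 is kept so that [w \o g] is convertible to [shift_env a%:Z 0 w]. *)
pose g (x : site d) : site d := (x.1 + a%:Z, x.2 + 0)%R.
transitivity (\int[P]_w ((F w s * (column_weight w s * \prod_(z <- s) t z))%:E *
   (G (w \o g) s' * (column_weight (w \o g) s' * \prod_(z <- s') t z))%:E)).
  apply: eq_integral => w _; rewrite -EFinM; congr (_%:E).
  rewrite -sa take_size_cat// drop_size_cat// column_weight_cat big_cat /= sa.
  rewrite -[shift_env _ _ _]/(w \o g); ring.
have ginj : injective g.
  by move=> [i y] [i' y'] []; rewrite !addr0 => /addIr -> ->.
have mGg : measurable_fun [set: env R d]
   (fun w : env R d => (G w s' * (column_weight w s' * \prod_(z <- s') t z))%:E).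
  exact: measurable_tilted_integrand.
rewrite (ge0_integralM_levels P_iid (a := a%:Z)); first last.
- move=> w w' ww'; congr ((_ * (_ * _))%:E).
    by apply: lG => x /andP[x0 _]; apply: ww'; rewrite /= lerDr.
  by apply: eq_bigr => i _; rewrite /= ww'//= lerDr.
- move=> w w' ww'; congr ((_ * (_ * _))%:E).
    by apply: lF => x /andP[_ xa]; exact: ww'.
  by apply: eq_bigr => i _; rewrite /= ww'//= ltz_nat -sa.
- by move=> w; exact: tilted_integrand_ge0.
- by move=> w; exact: tilted_integrand_ge0.
- exact: (measurableT_comp mGg (measurable_relabel g)).
- exact: measurable_tilted_integrand.
congr (_ * _).
rewrite (@ge0_integral_relabel _ _ _ P_iid g
  (fun w => (G w s' * (column_weight w s' * \prod_(z <- s') t z))%:E))//.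
by move=> w; exact: tilted_integrand_ge0.
Qed.

Lemma mean_stepE z : (mean_step P z)%:E = \int[P]_w (w (0, 0)%R z)%:E.
Proof.
rewrite /mean_step /Rintegral fineK// ge0_fin_numE; last first.
  by apply: integral_ge0 => w _; rewrite lee_fin pv_ge0.
rewrite (@le_lt_trans _ _ (\int[P]_w (cst 1 w)))//.
  apply: ge0_le_integral => //.
  - by move=> w _; rewrite lee_fin pv_ge0.
  - by apply/measurable_EFinP; exact: measurable_env_eval.
  - by move=> w _; rewrite lee_fin pv_le1.
by rewrite integral_cst// mul1e [ltLHS]probability_setT ltry.
Qed.

(** Total mass is multiplicative by [tilted_cat], so one step decides it. *)
Lemma tilted_one n :
  tilted P t n (fun _ _ => 1%R) = ((\sum_(z <- sphere) mean_step P z * t z) ^+ n)%:E.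
Proof.
elim: n => [|n IH].
  rewrite /tilted big_seq1 /column_weight.
  under eq_integral do rewrite big_nil big_ord0 !mul1r.
  by rewrite integral_cst// mul1e [LHS]probability_setT.
have /= := @tilted_cat 1 n (fun _ _ => 1%R) (fun _ _ => 1%R).
rewrite IH mulr1 exprS EFinM => ->//; congr (_ * _).
rewrite /tilted /= /seq.allpairs_dep /= flatten_map1 big_map -sumEFin.
apply: eq_bigr => z _; rewrite EFinM mean_stepE -ge0_integralZr//; last 3 first.
- by apply/measurable_EFinP; exact: measurable_env_eval.
- by move=> w _; rewrite lee_fin pv_ge0.
- by rewrite lee_fin.
apply: eq_integral => w _.
by rewrite /column_weight /= big_ord_recl big_ord0 big_seq1 mulr1 mul1r EFinM.
Qed.

End tilted.

Section tilted_le.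
Context {R : realType} {d : nat} (P : probability (env R d) R).
Variables (t t' : lattice d -> R).
Hypotheses (t0 : forall z, (0 <= t z)%R) (t'0 : forall z, (0 <= t' z)%R).
Local Open Scope ereal_scope.

(** The step weights may differ on the two sides: a change of measure becomes a pointwise comparison
    of functional times weight. *)
Lemma tilted_le n (F G : env R d -> seq (lattice d) -> R) :
  path_measurable F -> path_measurable G ->
  (forall w s, 0 <= F w s)%R -> 
  (forall w s, s \in @paths R d n ->
     F w s * \prod_(z <- s) t z <= G w s * \prod_(z <- s) t' z)%R ->
  tilted P t n F <= tilted P t' n G.
Proof.
move=> mF mG F0 FG; rewrite /tilted big_seq [leRHS]big_seq; apply: lee_sum => s sn.
apply: ge0_le_integral => //.
- by move=> w _; exact: tilted_integrand_ge0.
- exact: measurable_tilted_integrand.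
- exact: measurable_tilted_integrand.
- move=> w _; rewrite lee_fin mulrCA [leRHS]mulrCA ler_wpM2l ?column_weight_ge0//.
  exact: FG.
Qed.

End tilted_le.

Lemma shift_env_comp (R : realType) (d : nat) (i j : int) (w : env R d) :
  shift_env i 0 (shift_env j 0 w) = shift_env (i + j) 0 w.
Proof. by apply/funext => x; rewrite /shift_env /= !addr0 addrA. Qed.

Lemma shift_env0 (R : realType) (d : nat) (w : env R d) : shift_env 0 0 w = w.
Proof. by apply/funext => -[i x]; rewrite /shift_env /= !addr0. Qed.

(** * Products over disjoint blocks of levels and steps *)

Section blocks.
Context {R : realType} {d : nat} (P : probability (env R d) R) (P_iid : iid P).
Variables (t : lattice d -> R) (H : env R d -> seq (lattice d) -> R) (L : nat) (b : R).
Hypotheses (t0 : forall z, 0 <= t z) (mH : path_measurable H)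
  (H0 : forall w s, 0 <= H w s) (lH : local_levels L H)
  (Hb : (tilted P t L H <= b%:E)%E).

Let blocks m (w : env R d) s :=
  \prod_(k < m) H (shift_env (k * L)%N%:Z 0 w) (take L (drop (k * L) s)).

Let path_measurable_blocks m : path_measurable (blocks m).
Proof.
move=> s; apply: measurable_prod => k _.
exact: (measurableT_comp (mH _) (measurable_relabel (fun x => (x.1 + _, x.2 + 0)))).
Qed.

Let blocks_ge0 m w s : 0 <= blocks m w s.
Proof. exact: prodr_ge0. Qed.

Let local_levels_blocks m : local_levels (m * L) (blocks m).
Proof.
move=> w w' s ww'; apply: eq_bigr => k _; apply: lH => x /andP[x0 xL].
apply: ww'; rewrite /= addr_ge0//=.
rewrite (@lt_le_trans _ _ (L%:Z + (k * L)%N%:Z))// ?ltrD2r// -PoszD -mulSn lez_nat.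
by rewrite leq_mul2r ltn_ord orbT.
Qed.

Let tilted_blocks m : (tilted P t (m * L) (blocks m) <= (b ^+ m)%:E)%E.
Proof.
elim: m => [|m IH].
  rewrite mul0n expr0 -(expr0 (\sum_(z <- @sphere R d) mean_step P z * t z)).
  rewrite -(tilted_one P_iid t0); apply: tilted_le => // w s _.
  by rewrite /blocks big_ord0.
rewrite exprS EFinM; apply: (@le_trans _ _ (tilted P t L H * tilted P t (m * L) (blocks m))%E); last first.
  by apply: lee_pmul => //; exact: tilted_ge0.
rewrite -tilted_cat// mulSn; apply: tilted_le => //.
- move=> s; apply: measurable_funM; first exact: mH.
  exact: (measurableT_comp (path_measurable_blocks _ _) (measurable_relabel (fun x => (x.1 + _, x.2 + 0)))).
- move=> w s _; rewrite /blocks big_ord_recl mul0n shift_env0 drop0.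
  rewrite le_eqVlt; apply/orP; left; apply/eqP; congr (_ * _ * _).
  apply: eq_bigr => k _; rewrite shift_env_comp drop_drop -PoszD.
  have -> : (bump 0 k * L = k * L + L)%N by rewrite /bump leq0n add1n mulSn addnC.
  by [].

Qed.

(** The [m] blocks factorize, and the [r] free steps before them and [q] after them each contribute
    total mass 1, by normalization of the weights. *)
Lemma tilted_progression_le r m q :
  \sum_(z <- @sphere R d) mean_step P z * t z = 1 ->
  (tilted P t (r + (m * L + q)) (fun w s =>
     (\prod_(k < m) H (shift_env (r + k * L)%N%:Z 0 w) (take L (drop (r + k * L) s)))%R)
   <= (b ^+ m)%:E)%E.
Proof.
move=> t1; have V1 n : tilted P t n (fun _ _ => 1) = 1%E.
  by rewrite tilted_one// t1 expr1n.
have m1 : path_measurable (fun (_ : env R d) (_ : seq (lattice d)) => 1 : R) by [].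
(* The trailing factor 1 is the functional of the last [q] steps, in the shape that [tilted_cat]
   produces. *)
pose BB (w : env R d) s := blocks m w (take (m * L) s) * 1.
have mBB : path_measurable BB.
  by move=> s; apply: measurable_funM => //; exact: path_measurable_blocks.
apply: le_trans (tilted_blocks m).
rewrite -[leRHS]mule1 -(V1 q) -tilted_cat//.
rewrite -[leRHS]mul1e -{1}(V1 r) -tilted_cat//; last first.
- move=> w w' s ww'; rewrite !mulr1; apply: local_levels_blocks => x /andP[x0 xm].
  by apply: ww'; rewrite x0 (lt_le_trans xm)// lez_nat leq_addr.
- by move=> w s; rewrite mulr1; exact: blocks_ge0.
apply: tilted_le => //.
- move=> s; apply: measurable_prod => k _.
  exact: (measurableT_comp (mH _) (measurable_relabel (fun x => (x.1 + _, x.2 + 0)))).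
- move=> s; apply: measurable_funM => //.
  exact: (measurableT_comp (mBB _) (measurable_relabel (fun x => (x.1 + _, x.2 + 0)))).
- by move=> w s; apply: prodr_ge0.
- move=> w s _; rewrite mul1r mulr1 /blocks.
  rewrite le_eqVlt; apply/orP; left; apply/eqP; congr (_ * _).
  apply: eq_bigr => k _; rewrite shift_env_comp -PoszD addnC; congr (H _ _).
  have kL : (k * L + L <= m * L)%N by rewrite addnC -mulSn leq_mul2r ltn_ord orbT.
  rewrite -(subnK (leq_trans (leq_addr L _) kL)) -take_drop take_takel.
    by rewrite drop_drop addnC.
  by rewrite leq_subRL// (leq_trans (leq_addr L _) kL).
Qed.

End blocks.

(** * Windows of an observable *)

Section locality.
Context {R : realType} {d : nat}.

(** Sets determined by the levels in [D] form a sigma-algebra containing the generators. The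
    predicate [D] covers both [sigma_from] and [sigma_upto]. *)
Lemma sigma_levels_determined (D : pred int) (B : set (env R d)) :
  <<s [set B | exists (s : site d) (A : set (pvec R d)),
         D s.1 /\ measurable A /\ B = [set w : env R d | A (w s)]] >> B ->
  forall w w' : env R d, (forall x : site d, D x.1 -> w x = w' x) -> B w -> B w'.
Proof.
pose S : set (set (env R d)) := [set B | forall w w' : env R d,
  (forall x : site d, D x.1 -> w x = w' x) -> B w <-> B w'].
suff h : <<s [set B | exists (s : site d) (A : set (pvec R d)),
    D s.1 /\ measurable A /\ B = [set w : env R d | A (w s)]] >> `<=` S.
  by move=> sB w w' ww'; exact: (h _ sB w w' ww').1.
apply: smallest_sub; last first.
  by move=> _ [s [A [Ds [_ ->]]]] w w' ww' /=; rewrite ww'.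
split.
- by move=> w w' _.
- move=> A SA w w' /SA AE; rewrite /setD /=; split.
    by move=> [_ nA]; split => // /AE.
  by move=> [_ nA]; split => // /AE.
- by move=> F SF w w' ww'; split=> -[k _ Fk]; exists k => //; apply/(SF k _ _ ww').
Qed.

Variables (N M K : nat) (f : env R d * steps R d -> R).
Hypothesis f_obs : local_observable N M K f.

Lemma observable_local (w w' : env R d) (z z' : steps R d) :
  (forall x : site d, - N%:Z <= x.1 <= M%:Z -> w x = w' x) ->
  (forall i, (i < K)%N -> z i = z' i) -> f (w, z) = f (w', z').
Proof.
move=> ww' zz'; have [_ _ locz locw] := f_obs.
rewrite -(locz w' z z')//.
pose B := [set u : env R d | [set f (w, z)] (f (u, z))].
have [BN BM] : (sigma_from (- N%:Z) `&` sigma_upto M%:Z) B.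
  exact: locw (measurable_set1 _).
(* The environment is changed in two stages: levels below -N first, where the sigma-algebra of
   levels from -N is blind, then levels above M. *)
pose w'' : env R d := fun x => if - N%:Z <= x.1 then w x else w' x.
have Bw'' : B w''.
  apply: (@sigma_levels_determined (fun n => - N%:Z <= n) _ BN w) => //.
  by move=> x Nx; rewrite /w'' Nx.
suff : B w' by move=> /= ->.
apply: (@sigma_levels_determined (fun n => n <= M%:Z) _ BM w'') => // x xM.
by rewrite /w''; case: ifP => // Nx; rewrite ww'// Nx.
Qed.

(* The time origin of [f] is placed at level [N], so that a window reads only
   nonnegative levels. *)
Definition window (w : env R d) (s : seq (lattice d)) : R :=
  f (shift_env N%:Z (path_of s N) (recenter s w), steps_after R N (path_of s)).

Let L := (N + M + K + 1)%N.

Lemma path_measurable_window : path_measurable window.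
Proof.
move=> s; have [mf _ _ _] := f_obs.
exact: (measurableT_comp (measurableT_comp (measurable_observable_at N%:Z N mf)
  (measurable_pair2 (path_of s))) (measurable_recenter s)).
Qed.

Lemma local_levels_window : local_levels L window.
Proof.
move=> w w' s ww'; apply: observable_local => // x /andP[xN xM].
rewrite /shift_env /recenter /=; apply: ww' => /=; rewrite /L; apply/andP; split; lia.
Qed.

(** Seen from the walk, the recentered environment involves only differences of path positions, and
    the steps before time [j] cancel in them. The term of the ergodic sum at time [j + N] is thus a
    function of the levels and steps [j], ..., [j + L - 1] of the column picture. *)
Lemma observable_window (w : env R d) s j : (j + L <= size s)%N ->
  f (shift_env (j + N)%N%:Z (path_of s (j + N)) (recenter s w),
     steps_after R (j + N) (path_of s)) =
  window (shift_env j%:Z 0 w) (take L (drop j s)).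
Proof.
move=> jL; have pE k : (k <= L)%N ->
    path_of (take L (drop j s)) k = path_of s (j + k)%N - path_of s j.
  by move=> kL; rewrite path_of_take// path_of_drop.
apply: observable_local => [x /andP[xN xM]|i iK].
  rewrite /shift_env /recenter /=.
  (* [k] is the index of the level inside the window; the lower bound -N on [x.1] makes it
     nonnegative. *)
  have [k kE] : exists k : nat, x.1 + N%:Z = k%:Z by exists (absz (x.1 + N%:Z)); lia.
  have kL : (k <= L)%N by rewrite /L; lia.
  have -> : x.1 + (j + N)%N%:Z = (j + k)%N%:Z by rewrite !PoszD -kE; ring.
  rewrite kE -PoszD addnC; congr (w (_, _)).
  rewrite !pE//; last by rewrite /L; lia.
  by rewrite addr0 [(k + j)%N]addnC opprB -[RHS]addrA subrKA addrA.
rewrite /steps_after; congr insubd.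
rewrite !pE /L; [|lia|lia].
by rewrite opprB addrA subrK addnS addnA.
Qed.

End locality.

(** * Exponential tilting *)

Section dot.
Context {R : realType} {d : nat}.

Lemma embedD (x y : lattice d) : embed R (x + y) = embed R x + embed R y.
Proof. by apply/rowP => i; rewrite !mxE rmorphD. Qed.

Lemma embed0 : embed R (0 : lattice d) = 0.
Proof. by apply/rowP => i; rewrite !mxE. Qed.

Lemma dotDr (u v w : 'rV[R]_d.+1) : dot u (v + w) = dot u v + dot u w.
Proof. by rewrite /dot -big_split /=; apply: eq_bigr => i _; rewrite mxE mulrDr. Qed.

Lemma dotDl (u v w : 'rV[R]_d.+1) : dot (u + v) w = dot u w + dot v w.
Proof. by rewrite /dot -big_split /=; apply: eq_bigr => i _; rewrite mxE mulrDl. Qed.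

Lemma dot0r (u : 'rV[R]_d.+1) : dot u 0 = 0.
Proof. by rewrite /dot big1// => i _; rewrite mxE mulr0. Qed.

Lemma dotZr (a : R) (u v : 'rV[R]_d.+1) : dot u (a *: v) = a * dot u v.
Proof. by rewrite /dot big_distrr; apply: eq_bigr => i _; rewrite mxE mulrCA. Qed.

Lemma dot_delta (h : R) i (v : 'rV[R]_d.+1) : dot (h *: delta_mx 0 i) v = h * v 0 i.
Proof.
rewrite /dot (bigD1 i)//= big1 => [|j ji]; first by rewrite !mxE !eqxx mulr1 addr0.
by rewrite !mxE (negbTE ji) andbF mulr0 mul0r.
Qed.

Definition norm1 (u : 'rV[R]_d.+1) : R := \sum_i `|u 0 i|.

Lemma norm1_ge0 u : 0 <= norm1 u.
Proof. exact: sumr_ge0. Qed.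

Lemma coord_le_enorm (v : 'rV[R]_d.+1) i : `|v 0 i| <= enorm v.
Proof.
rewrite /enorm -sqrtr_sqr ler_wsqrtr// /dot (bigD1 i)//= -expr2 lerDl.
by apply: sumr_ge0 => j _; rewrite -expr2 sqr_ge0.
Qed.

Lemma dot_le (u v : 'rV[R]_d.+1) : `|dot u v| <= norm1 u * enorm v.
Proof.
rewrite /dot (le_trans (ler_norm_sum _ _ _))// /norm1 big_distrl /=.
apply: ler_sum => i _; rewrite normrM ler_wpM2l//; exact: coord_le_enorm.
Qed.

Lemma enorm_le_coord (v : 'rV[R]_d.+1) (e : R) : 0 < e ->
  (forall i, `|v 0 i| <= e / d.+1%:R) -> enorm v <= e.
Proof.
move=> e0 ve; apply: (@le_trans _ _ (Num.sqrt (e ^+ 2))).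
  apply: ler_wsqrtr.
  apply: (@le_trans _ _ (\sum_(i < d.+1) (e / d.+1%:R) ^+ 2)).
    apply: ler_sum => i _; rewrite -expr2 -real_normK ?num_real// ler_sqr ?nnegrE//.
    by rewrite divr_ge0// ltW.
  rewrite sumr_const card_ord expr_div_n -[X in X <= _]mulr_natr -mulrA ler_piMr ?sqr_ge0//.
  by rewrite expr2 invfM -mulrA mulVf ?pnatr_eq0// mulr1 invf_le1 ?ltr0n// ler1n.
by rewrite sqrtr_sqr gtr0_norm.
Qed.

Lemma path_of_size (s : seq (lattice d)) : path_of s (size s) = \sum_(z <- s) z.
Proof. by rewrite (big_nth 0) big_mkord. Qed.

End dot.

(* Squaring [1 - x / 2 <= expR (- x / 2)] gives the bound for [expR (- x)]. *)
Lemma expR_le_quad (R : realType) (x : R) : `|x| <= 3^-1 -> expR x <= 1 + x + x ^+ 2.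
Proof.
move=> x1; have xb : - (3^-1) <= x <= 3^-1 by rewrite -ler_norml.
have h1 : 1 - x / 2 <= expR (- (x / 2)) by exact: expR_ge1Dx.
have h2 : (1 - x / 2) ^+ 2 <= expR (- x).
  rewrite (_ : - x = - (x / 2) + - (x / 2)); last by field.
  rewrite expRD -expr2 ler_sqr ?nnegrE ?expR_ge0//; lra.
have h3 : 1 <= (1 - x / 2) ^+ 2 * (1 + x + x ^+ 2).
  have -> : (1 - x / 2) ^+ 2 * (1 + x + x ^+ 2) = 1 + x ^+ 2 * (1 - 3 * x + x ^+ 2) / 4 by field.
  rewrite lerDl divr_ge0// mulr_ge0 ?sqr_ge0//.
  have := sqr_ge0 x; lra.
have q0 : 0 <= 1 + x + x ^+ 2 by have := sqr_ge0 x; lra.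
have h4 : 1 <= expR (- x) * (1 + x + x ^+ 2).
  by rewrite (le_trans h3)// ler_wpM2r.
by rewrite -[leLHS]mulr1 -ler_pdivlMl ?expR_gt0// -expRN.
Qed.

Section tilt.
Context {R : realType} {d : nat}.
Variables (P : probability (env R d) R) (Q : R.-pker (env R d) ~> traj d).
Hypotheses (P_iid : iid P) (P_nn : nearest_neighbor P) (Q_law : quenched_law Q).
Notation sphere := (@sphere R d).

Definition tilt (theta : 'rV[R]_d.+1) (z : lattice d) : R :=
  expR (dot theta (embed R z) - ln (phi P theta)).

(** The weight of a path depends on its length and endpoint alone, which is why knowing the velocity
    controls the change of measure. *)
Lemma prod_tilt theta s : \prod_(z <- s) tilt theta z =
  expR (dot theta (embed R (path_of s (size s))) - (size s)%:R * ln (phi P theta)).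
Proof.
rewrite path_of_size; elim: s => [|z s IH].
  by rewrite !big_nil embed0 dot0r mul0r subr0 expR0.
rewrite !big_cons IH -expRD; congr expR.
by rewrite embedD dotDr /= -natr1; ring.
Qed.

Lemma phiE theta : phi P theta = \sum_(z <- sphere) mean_step P z * expR (dot theta (embed R z)).
Proof. by rewrite /phi fsbig_finite//; exact: finite_sphere. Qed.

Lemma mean_step_ge0 z : 0 <= mean_step P z.
Proof. by rewrite -lee_fin mean_stepE integral_ge0// => w _; rewrite lee_fin pv_ge0. Qed.

(** The total mass of the averaged measure, computed on one-step paths with trivial weights. *)
Lemma sum_mean_step : \sum_(z <- sphere) mean_step P z = 1.
Proof.
have h : (\int[semidirect P Q]_p 1%:E = 1)%E.
  by rewrite integral_cst// mul1e; exact: probability_setT.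
move: h; rewrite (@walk_tilted _ _ P Q P_iid P_nn Q_law 1 (fun=> 1))//.
rewrite tilted_one// expr1 => -[] h; rewrite -[RHS]h.
by apply: eq_bigr => z _; rewrite mulr1.
Qed.

Lemma phi_gt0 theta : 0 < phi P theta.
Proof.
rewrite phiE lt_neqAle; apply/andP; split; last first.
  by apply: sumr_ge0 => z _; rewrite mulr_ge0 ?mean_step_ge0 ?expR_ge0.
rewrite eq_sym psumr_eq0; last first.
  by move=> z _; rewrite mulr_ge0 ?mean_step_ge0 ?expR_ge0.
apply/negP => /allP h.
have := sum_mean_step; rewrite big_seq big1; first by move/eqP; rewrite eq_sym oner_eq0.
by move=> z /h /=; rewrite mulf_eq0 (gt_eqF (expR_gt0 _)) orbF => /eqP.
Qed.

Lemma sum_tilt theta theta' : \sum_(z <- sphere) mean_step P z *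
    (expR (dot theta' (embed R z)) * expR (- ln (phi P theta))) =
  phi P theta' / phi P theta.
Proof.
under eq_bigr do rewrite mulrA.
by rewrite -big_distrl /= -phiE expRN lnK// posrE phi_gt0.
Qed.

Lemma tilt_normalized theta : \sum_(z <- sphere) mean_step P z * tilt theta z = 1.
Proof.
under eq_bigr do rewrite /tilt expRD.
by rewrite sum_tilt divff// gt_eqF// phi_gt0.
Qed.

End tilt.

(** * Exponential moments of a bounded functional under the tilted law *)

Section moment.
Context {R : realType} {d : nat} (P : probability (env R d) R) (P_iid : iid P).
Variables (t : lattice d -> R).
Hypotheses (t0 : forall z, 0 <= t z)
  (t1 : \sum_(z <- @sphere R d) mean_step P z * t z = 1).

Lemma tilted_cst n (c : R) : 0 <= c -> tilted P t n (fun _ _ => c) = c%:E.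
Proof.
move=> c0; have := @tiltedZ _ _ P t t0 n c (fun _ _ => 1) c0.
rewrite mulr1 => ->//.
by rewrite tilted_one// t1 expr1n mule1.
Qed.

Variables (L : nat) (G : env R d -> seq (lattice d) -> R) (C : R).
Hypotheses (mG : path_measurable G) (GC : forall w s, `|G w s| <= C).

Let C_ge0 : 0 <= C.
Proof. by apply: le_trans (GC point [::]). Qed.

Let GC0 w s : 0 <= G w s + C.
Proof. by have := GC w s; rewrite ler_norml -lerBlDr sub0r => /andP[]. Qed.

Let mGC : path_measurable (fun w s => G w s + C).
Proof. by move=> s; apply: measurable_funD => //; exact: mG. Qed.

(** The hypothesis encodes that the signed functional [G] has tilted mean [m], shifted by [C] to
    keep it nonnegative. *)
Lemma tilted_mean_bound (m : R) :
  tilted P t L (fun w s => G w s + C) = (m + C)%:E -> `|m| <= C.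
Proof.
move=> hm; have h1 : 0 <= m + C by rewrite -lee_fin -hm; exact: tilted_ge0.
have h2 : m + C <= C + C.
  rewrite -lee_fin -hm -(@tilted_cst L)//; last by rewrite addr_ge0.
  apply: tilted_le => // w s _; rewrite ler_wpM2r ?step_prod_ge0// lerD2r.
  by have := GC w s; rewrite ler_norml => /andP[].
by rewrite ler_norml; apply/andP; split; lra.
Qed.

(** The exponent is at most 1/3 in absolute value, so the quadratic bound on [expR] applies; the
    linear term has mean 0, and 1 + q is at most e^q. *)
Lemma tilted_mgf_le (m lambda : R) :
  tilted P t L (fun w s => G w s + C) = (m + C)%:E ->
  0 <= lambda -> lambda * (2 * C) <= 3^-1 ->
  (tilted P t L (fun w s => expR (lambda * (G w s - m))) <=
   (expR ((lambda * (2 * C)) ^+ 2))%:E)%E.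
Proof.
move=> hm l0 lC; have mC := tilted_mean_bound hm.
have mC0 : 0 <= m + C by move: mC; rewrite ler_norml => /andP[]; lra.
set q := (lambda * (2 * C)) ^+ 2.
have q0 : 0 <= q by exact: sqr_ge0.
have me : path_measurable (fun w s => expR (lambda * (G w s - m))).
  move=> s; apply: measurableT_comp => //; apply: measurable_funM => //.
  by apply: measurable_funB => //; exact: mG.
have mc (c : R) : path_measurable (fun (_ : env R d) (_ : seq (lattice d)) => c) by [].
have mlG : path_measurable (fun w s => lambda * (G w s + C)).
  by move=> s; apply: measurable_funM => //; exact: mGC.
(* Adding [lambda * (m + C)] to both sides turns the signed linear term into the nonnegative
   [lambda * (G + C)]; the added constant cancels after integration. *)
have ineq : (tilted P t L (fun w s => expR (lambda * (G w s - m)) + lambda * (m + C))%R <=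
             tilted P t L (fun w s => (1 + q) + lambda * (G w s + C))%R)%E.
  apply: tilted_le => //.
  - by move=> s; apply: measurable_funD => //; exact: me.
  - by move=> s; apply: measurable_funD => //; exact: mlG.
  - by move=> w s; rewrite addr_ge0 ?expR_ge0// mulr_ge0.
  move=> w s _; rewrite ler_wpM2r ?step_prod_ge0//.
  have Gm : `|lambda * (G w s - m)| <= lambda * (2 * C).
    rewrite normrM ger0_norm// ler_wpM2l// (le_trans (ler_normB _ _))//.
    by have := GC w s; lra.
  have := expR_le_quad (le_trans Gm lC).
  have : (lambda * (G w s - m)) ^+ 2 <= q.
    by rewrite -real_normK ?num_real// /q ler_sqr ?nnegrE// mulr_ge0// mulr_ge0.
  lra.
move: ineq; rewrite !tiltedD//; try by move=> w s; rewrite ?addr_ge0 ?mulr_ge0.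
rewrite !tilted_cst ?mulr_ge0// tiltedZ// hm -EFinM -(EFinD 1 q) leeD2rE// => h.
by rewrite (le_trans h)// lee_fin expR_ge1Dx.
Qed.

(** The functionals [- G + C] and [G + C] add up to the constant 2C, of known mass. This gives the
    lower tail. *)
Lemma tilted_mean_opp (m : R) :
  tilted P t L (fun w s => G w s + C) = (m + C)%:E ->
  tilted P t L (fun w s => - G w s + C) = (- m + C)%:E.
Proof.
move=> hm.
have GC0' w s : 0 <= - G w s + C.
  by have := GC w s; rewrite ler_norml addrC subr_ge0 => /andP[].
have mGC' : path_measurable (fun w s => - G w s + C).
  by move=> s; apply: measurable_funD => //; apply: measurableT_comp => //; exact: mG.
have : tilted P t L (fun w s => (- G w s + C) + (G w s + C)) = (C + C)%:E.
  rewrite -(@tilted_cst L)//; last by rewrite addr_ge0.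
  by congr (tilted _ _ _ _); apply/funext => w; apply/funext => s; ring.
rewrite tiltedD// hm; case: (tilted _ _ _ _) => [x||]//= [] xm; congr (_%:E); lra.
Qed.

Hypothesis lG : local_levels L G.

Lemma tilted_progression_mgf_le (m lambda : R) k r q :
  tilted P t L (fun w s => G w s + C) = (m + C)%:E ->
  0 <= lambda -> lambda * (2 * C) <= 3^-1 ->
  (tilted P t (r + (k * L + q)) (fun w s => (expR (lambda *
     \sum_(i < k) (G (shift_env (r + i * L)%N%:Z 0 w) (take L (drop (r + i * L) s)) - m)))%R)
   <= (expR (k%:R * (lambda * (2 * C)) ^+ 2))%:E)%E.
Proof.
move=> hm l0 lC.
have me : path_measurable (fun w s => expR (lambda * (G w s - m))).
  move=> s; apply: measurableT_comp => //; apply: measurable_funM => //.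
  by apply: measurable_funB => //; exact: mG.
have le : local_levels L (fun w s => expR (lambda * (G w s - m))).
  by move=> w w' s ww'; rewrite (lG s ww').
have := @tilted_progression_le _ _ _ P_iid t _ L _ t0 me (fun _ _ => expR_ge0 _) le
  (tilted_mgf_le hm l0 lC) r k q t1.
rewrite expRM_natl; apply: le_trans.
rewrite le_eqVlt; apply/orP; left; apply/eqP.
congr (tilted _ _ _ _); apply/funext => w; apply/funext => s.
by rewrite big_distrr /= expR_sum.
Qed.

End moment.

(** * The mean of a window and the velocity *)

Lemma eventually_ge_linear (R : realType) (a A : R) : 0 < a ->
  exists n0 : nat, forall n, (n0 <= n)%N -> A <= n%:R * a.
Proof.
move=> a0; exists (Num.truncn (A / a)).+1 => n n0.
rewrite -ler_pdivrMr// ltW// (lt_le_trans (truncnS_gt _))//.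
by rewrite ler_nat.
Qed.

Section window_mean.
Context {R : realType} {d : nat}.
Variables (P : probability (env R d) R) (Q : R.-pker (env R d) ~> traj d).
Hypotheses (P_iid : iid P) (P_nn : nearest_neighbor P) (Q_law : quenched_law Q).
Variables (theta : 'rV[R]_d.+1) (mu : probability (env R d * steps R d)%type R).
Hypothesis mu_int : forall (N M K : nat) (f : env R d * steps R d -> R),
  local_observable N M K f ->
  (\int[mu]_p (f p)%:E =
   \int[semidirect P Q]_p
     (expR (dot theta (embed R (p.2 (N + M + K + 1)%N))
            - (N + M + K + 1)%:R * ln (phi P theta))
      * f (shift_env N%:Z (p.2 N) p.1, steps_after R N p.2))%:E)%E.
Variables (N M K : nat) (f : env R d * steps R d -> R) (C : R).
Hypotheses (f_obs : local_observable N M K f) (fC : forall p, `|f p| <= C).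

Let observable_addr : local_observable N M K (fun p => f p + C).
Proof.
have [mf _ locz locw] := f_obs; split.
- exact: measurable_funD.
- exists (C + C) => p; rewrite (le_trans (ler_normD _ _))// lerD//.
  by rewrite ger0_norm// (le_trans _ (fC p)).
- by move=> w z z' zz'; rewrite (locz w z z').
- move=> z B mB; apply: (locw z ((fun x => x + C) @^-1` B)).
  rewrite -[X in measurable X]setTI.
  by apply: (measurable_funD (@measurable_id _ _ setT) (measurable_cst C)).
Qed.

(** The weight in the defining formula of [mu] is the product of the step weights over the window,
    by [prod_tilt]. The formula is applied to [f + C], which is nonnegative and again a local
    observable; [mu] having mass 1 gives [C] back. *)
Lemma tilted_window_mean :
  tilted P (tilt P theta) (N + M + K + 1) (fun w s => window N f w s + C) =
  (\int[mu]_p f p + C)%:E.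
Proof.
have [mf _ _ _] := f_obs.
have fC0 p : 0 <= f p + C by have := fC p; rewrite ler_norml -lerBlDr sub0r => /andP[].
transitivity (\int[mu]_p (f p + C)%:E)%E; last first.
  have fi : mu.-integrable setT (EFin \o f).
    apply: measurable_bounded_integrable => //.
      by rewrite [ltLHS]probability_setT ltry.
    exists C; split; first exact: num_real.
    by move=> x Cx p _ /=; rewrite (le_trans (fC p))// ltW.
  rewrite /Rintegral EFinD fineK; last by apply: integrable_fin_num.
  rewrite -[LHS]/(\int[mu]_p ((EFin \o f) p + (EFin \o cst C) p))%E.
  rewrite integralD//; last exact: finite_measure_integrable_cst.
  congr (_ + _)%E; transitivity (C%:E * mu setT)%E; first by rewrite -integral_cst.
  by rewrite [X in (_ * X)%E]probability_setT mule1.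
rewrite (mu_int observable_addr).
rewrite (@walk_tilted _ _ P Q P_iid P_nn Q_law (N + M + K + 1) (fun p =>
  expR (dot theta (embed R (p.2 (N + M + K + 1)%N)) - (N + M + K + 1)%:R * ln (phi P theta))
      * (f (shift_env N%:Z (p.2 N) p.1, steps_after R N p.2) + C))); last first.
- move=> w X X' XX' /=; rewrite !XX' //; last by rewrite -!addnA leq_addr.
  congr (_ * (_ + _)); apply: (observable_local f_obs) => // i iK.
  by rewrite /steps_after !XX' //; lia.
- by move=> p; rewrite mulr_ge0 ?expR_ge0.
- apply: measurable_funM; last by apply: measurable_funD => //; exact: measurable_observable_at.
  exact: (measurableT_comp (measurable_fun_lattice (fun y : lattice d =>
    expR (dot theta (embed R y) - (N + M + K + 1)%:R * ln (phi P theta)))) (measurable_traj_eval _)).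
apply: eq_big_seq => s /size_paths sn; apply: eq_integral => w _ /=; congr (_%:E).
by rewrite big1_eq prod_tilt sn /window; ring.
Qed.

End window_mean.

Section velocity.
Context {R : realType} {d : nat}.
Variables (P : probability (env R d) R) (Q : R.-pker (env R d) ~> traj d).
Hypotheses (P_iid : iid P) (P_nn : nearest_neighbor P) (Q_law : quenched_law Q).
Variables (theta xi : 'rV[R]_d.+1).
Hypothesis grad : grad_log_phi P theta xi.

(** First-order expansion of log phi along the coordinate axes; there are finitely many axes and two
    signs, so one step size [h0] serves all. *)
Lemma log_phi_increment_le (eta : R) : 0 < eta ->
  exists2 h0 : R, 0 < h0 & forall h i, `|h| = h0 ->
    ln (phi P (theta + h *: delta_mx 0 i)) - ln (phi P theta) <= h * xi 0 i + h0 * eta.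
Proof.
move=> eta0.
have : \forall h \near (0 : R)^', forall i : 'I_d.+1,
    ln (phi P (theta + h *: delta_mx 0 i)) - ln (phi P theta) <= h * xi 0 i + `|h| * eta.
  apply: filter_forall => i.
  have [gd gv] := grad i.
  have : (fun h : R => h^-1 *: (((fun u => ln (phi P u)) \o shift theta) (h *: delta_mx 0 i) -
     ln (phi P theta))) @ 0^' --> xi 0 i by rewrite -gv; exact: gd.
  move=> /cvgrPdist_le /(_ eta eta0) He.
  near=> h.
  have h0 : h != 0 by near: h; exact: nbhs_dnbhs_neq.
  have : `|xi 0 i - h^-1 * (ln (phi P (h *: delta_mx 0 i + theta)) - ln (phi P theta))| <= eta.
    by near: h; exact: He.
  rewrite [_ + theta]addrC => Hh.
  set D := ln _ - ln _ in Hh *.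
  have -> : D = h * xi 0 i - h * (xi 0 i - h^-1 * D) by field.
  rewrite lerD2l (le_trans (ler_norm _))// normrN normrM ler_wpM2l//.
rewrite /dnbhs /within /= -nbhs_ballE => -[e /= e0 He].
exists (e / 2) => [|h i he]; first by rewrite divr_gt0.
rewrite -he; apply: He => //.
  by rewrite /ball /= sub0r normrN he gtr_pMr// invf_lt1 ?ltr1n.
by rewrite -normr_gt0 he divr_gt0.
Unshelve. all: by end_near.
Qed.

(** Chernoff's bound for one coordinate: the extra exponential moves the tilt from theta to theta +
    h e_i, with total mass (phi(theta + h e_i) / phi(theta))^n. The subtracted 2 eta per step
    exceeds the expansion error eta by eta. *)
Lemma tilted_coord_le (h : R) (i : 'I_d.+1) (eta : R) n :
  ln (phi P (theta + h *: delta_mx 0 i)) - ln (phi P theta) <= h * xi 0 i + eta ->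
  (tilted P (tilt P theta) n (fun w s =>
     expR (h * (embed R (path_of s n) 0 i - n%:R * xi 0 i) - n%:R * (2 * eta))%R) <=
   (expR (- (n%:R * eta)))%:E)%E.
Proof.
move=> hle; set c := expR (- (n%:R * (h * xi 0 i + 2 * eta))).
(* The factor [expR (h * X_n)] is absorbed in the step weights, which leaves the constant functional
   [c]. *)
pose t' z := expR (h * embed R z 0 i) * tilt P theta z.
have t0 z : 0 <= tilt P theta z by exact: expR_ge0.
have t'0 z : 0 <= t' z by rewrite mulr_ge0 ?expR_ge0.
apply: (@le_trans _ _ (tilted P t' n (fun _ _ => c * 1))).
  apply: tilted_le => // w s sn; rewrite /t' big_split /= mulr1.
  have -> : \prod_(z <- s) expR (h * embed R z 0 i) = expR (h * embed R (path_of s n) 0 i).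
    rewrite -(size_paths sn) path_of_size; elim: s {sn} => [|z s IH].
      by rewrite !big_nil embed0 mxE mulr0 expR0.
    by rewrite !big_cons IH -expRD -mulrDr embedD [in RHS]mxE.
  rewrite [leRHS]mulrA /c -expRD ler_wpM2r ?prodr_ge0//.
  by rewrite ler_expR le_eqVlt; apply/orP; left; apply/eqP; ring.
rewrite tiltedZ ?expR_ge0// tilted_one// -EFinM lee_fin.
have -> : \sum_(z <- @sphere R d) mean_step P z * t' z =
   expR (ln (phi P (theta + h *: delta_mx 0 i)) - ln (phi P theta)).
  rewrite expRD lnK ?posrE ?(phi_gt0 P_iid P_nn Q_law)// expRN lnK ?posrE ?(phi_gt0 P_iid P_nn Q_law)//.
  rewrite -(sum_tilt P_iid P_nn Q_law); apply: eq_bigr => z _; congr (_ * _).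
  by rewrite /t' /tilt -!expRD dotDl dot_delta; congr expR; ring.
rewrite -expRM_natl /c -expRD ler_expR.
rewrite (@le_trans _ _ (- (n%:R * (h * xi 0 i + 2 * eta)) + n%:R * (h * xi 0 i + eta)))//.
  by rewrite lerD2l ler_wpM2l.
by rewrite le_eqVlt; apply/orP; left; apply/eqP; ring.
Qed.

Definition near_path (delta : R) (n : nat) (s : seq (lattice d)) : bool :=
  enorm (n%:R^-1 *: embed R (path_of s n) - xi) <= delta.

(** Off the event, some coordinate deviates by more than n e with e = delta / (d+1). This gives
    2(d+1) one-sided events, each of mass at most 1 / (4(d+1)). *)
Lemma tilted_near_path_ge (delta : R) : 0 < delta ->
  exists n0 : nat, forall n, (n0 <= n)%N ->
   ((2^-1)%:E <= tilted P (tilt P theta) n (fun _ s => (near_path delta n s)%:R : R))%E.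
Proof.
move=> delta0; pose e := delta / d.+1%:R.
have e0 : 0 < e by rewrite divr_gt0.
have e20 : 0 < e / 2 by rewrite divr_gt0.
have [h0 h00 Hh] := log_phi_increment_le e20.
(* The Chernoff bound is e^(-x) with x = n h0 e / 2; since e^x is at least x, it suffices that x
   reach 4(d+1). *)
have [n0 Hn0] := @eventually_ge_linear R (h0 * (e / 2)) (4 * d.+1%:R) (mulr_gt0 h00 e20).
exists (maxn n0 1) => n; rewrite geq_max => /andP[/Hn0 n0n n1].
have n_gt0 : 0 < n%:R :> R by rewrite ltr0n.
have t0 z : 0 <= tilt P theta z by exact: expR_ge0.
pose E (h : R) (i : 'I_d.+1) (w : env R d) s : R :=
  expR (h * (embed R (path_of s n) 0 i - n%:R * xi 0 i) - n%:R * (2 * (h0 * (e / 2)))).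
have EE h i : `|h| = h0 -> (tilted P (tilt P theta) n (E h i) <= ((4 * d.+1%:R)^-1)%:E)%E.
  move=> hh; apply: le_trans (tilted_coord_le _ (Hh h i hh)) _.
  rewrite lee_fin expRN lef_pV2 ?posrE ?expR_gt0//.
  by rewrite (le_trans n0n)// (le_trans _ (expR_ge1Dx _))// lerDr.
pose B (w : env R d) s : R := \sum_(i < d.+1) (E h0 i w s + E (- h0) i w s).
have mE h i : path_measurable (E h i) by move=> s.
have E0 h i w s : 0 <= E h i w s by exact: expR_ge0.
have mE2 i : path_measurable (fun w s => E h0 i w s + E (- h0) i w s).
  by move=> s; apply: measurable_funD; exact: mE.
have mB : path_measurable B by move=> s; apply: measurable_sum => i; exact: mE2.
have B0 w s : 0 <= B w s by apply: sumr_ge0 => i _; rewrite addr_ge0.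
have mD : path_measurable (fun (_ : env R d) s => (near_path delta n s)%:R : R) by move=> s.
have key : (1 <= tilted P (tilt P theta) n (fun w s => (near_path delta n s)%:R + B w s)%R)%E.
  rewrite -(@tilted_cst _ _ P P_iid (tilt P theta) t0 (tilt_normalized P_iid P_nn Q_law theta) n 1)//.
  apply: tilted_le => //.
    by move=> s; apply: measurable_funD => //; exact: mB.
  move=> w s _; rewrite ler_wpM2r ?prodr_ge0//.
  case: (boolP (near_path delta n s)) => [_|nD]; first by rewrite lerDl.
  rewrite add0r.
  have [i Hi] : exists i, e < `|(n%:R^-1 *: embed R (path_of s n) - xi) 0 i|.
    apply: contrapT => /forallNP nE; move/negP: nD; apply.
    by apply: enorm_le_coord => // i; rewrite leNgt; apply/negP.
  rewrite /B (bigD1 i)//= -[leLHS]addr0 lerD//; last first.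
    by apply: sumr_ge0 => j _; rewrite addr_ge0.
  have Hi' : n%:R * e < `|embed R (path_of s n) 0 i - n%:R * xi 0 i|.
    rewrite (_ : embed R (path_of s n) 0 i - n%:R * xi 0 i =
       n%:R * (n%:R^-1 *: embed R (path_of s n) - xi) 0 i); last first.
      by rewrite !mxE; field; rewrite gt_eqF.
    by rewrite normrM (gtr0_norm n_gt0) ltr_pM2l.
  move: Hi'; set x := (_ - n%:R * xi 0 i); have [x0|x0] := ger0P x => Hx.
    rewrite -[leLHS]addr0 lerD// -expR0 /E ler_expR -/x.
    have : 0 <= h0 * (x - n%:R * e) by rewrite mulr_ge0 ?ltW// subr_gt0.
    lra.
  rewrite -[leLHS]add0r lerD// -expR0 /E ler_expR -/x.
  have : 0 <= h0 * (- x - n%:R * e) by rewrite mulr_ge0 ?ltW// subr_gt0.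
  lra.
have : (tilted P (tilt P theta) n (fun w s => (near_path delta n s)%:R + B w s)%R <=
   tilted P (tilt P theta) n (fun _ s => (near_path delta n s)%:R : R) + (2^-1)%:E)%E.
  rewrite tiltedD// leeD2l// tilted_sum//; last by move=> i w s; rewrite addr_ge0.
  apply: (@le_trans _ _ (\sum_(i < d.+1) ((2 * d.+1%:R)^-1)%:E)%E).
    apply: lee_sum => i _; rewrite tiltedD//.
    rewrite (_ : (2 * d.+1%:R)^-1 = (4 * d.+1%:R)^-1 + (4 * d.+1%:R)^-1); last first.
      by field; rewrite nat1r pnatr_eq0.
    by rewrite EFinD leeD// EE// ?normrN gtr0_norm.
  rewrite sumEFin lee_fin sumr_const card_ord -[X in X <= _]mulr_natr.
  rewrite le_eqVlt; apply/orP; left; apply/eqP.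
  by field; rewrite nat1r pnatr_eq0.
move=> /(le_trans key); rewrite (_ : 1%E = (2^-1)%:E + (2^-1)%:E)%E; last first.
  by rewrite -EFinD; congr (_%:E); field.
by rewrite leeD2rE.
Qed.

End velocity.

(** * Sums over residue classes *)

Section block_sums.
Context {R : realType}.

Lemma sum_residues (g : nat -> R) L k :
  \sum_(r < L) \sum_(i < k) g (r + i * L)%N = \sum_(j < k * L) g j.
Proof.
elim: k g => [|k IH] g.
  by rewrite mul0n big_ord0 big1// => r _; rewrite big_ord0.
rewrite mulSn big_split_ord /= -(IH (fun j => g (L + j)%N)) -big_split /=.
apply: eq_bigr => r _; rewrite big_ord_recl /= mul0n addn0; congr (_ + _).
apply: eq_bigr => i _; congr g.
by rewrite /bump leq0n add1n mulSn addnCA.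
Qed.

Variables (u : nat -> R) (D : R).
Hypothesis uD : forall j, `|u j| <= D.

Let D0 : 0 <= D. Proof. exact: le_trans (uD 0). Qed.

Lemma norm_sum_le n : `|\sum_(j < n) u j| <= n%:R * D.
Proof.
rewrite (le_trans (ler_norm_sum _ _ _))//.
rewrite (le_trans (ler_sum _ (fun j _ => uD (j : 'I_n))))//.
by rewrite sumr_const card_ord mulr_natl.
Qed.

(** The two sums differ by at most L terms from truncating to m, N lost at the start and N gained at
    the end. *)
Lemma norm_sum_shift_le n N m L : (m <= n <= m + L)%N ->
  `|\sum_(j < n) u j - \sum_(j < m) u (N + j)%N| <= (N + N + L)%:R * D.
Proof.
move=> /andP[mn nmL].
have split_sum a b : \sum_(j < a + b) u j = \sum_(j < a) u j + \sum_(j < b) u (a + j)%N.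
  by rewrite big_split_ord.
have -> : \sum_(j < m) u (N + j)%N = \sum_(j < m + N) u j - \sum_(j < N) u j.
  by rewrite addnC split_sum addrC addKr.
have -> : \sum_(j < n) u j = \sum_(j < m) u j + \sum_(j < n - m) u (m + j)%N.
  by rewrite -split_sum subnKC.
rewrite split_sum.
have tail a b : `|\sum_(j < b) u (a + j)%N| <= b%:R * D.
  rewrite (le_trans (ler_norm_sum _ _ _))//.
  rewrite (le_trans (ler_sum _ (fun j _ => uD (a + (j : 'I_b))%N)))//.
  by rewrite sumr_const card_ord mulr_natl.
have h1 := tail m (n - m)%N; have h2 := tail m N; have h3 := norm_sum_le N.
have h4 : (n - m)%:R * D <= L%:R * D by rewrite ler_wpM2r// ler_nat leq_subLR.
have -> : \sum_(j < m) u j + \sum_(j < n - m) u (m + j)%N -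
   (\sum_(j < m) u j + \sum_(j < N) u (m + j)%N - \sum_(j < N) u j) =
   \sum_(j < n - m) u (m + j)%N - \sum_(j < N) u (m + j)%N + \sum_(j < N) u j by ring.
rewrite (le_trans (ler_normD _ _))// !natrD !mulrDl.
have := ler_normB (\sum_(j < n - m) u (m + j)%N) (\sum_(j < N) u (m + j)%N).
lra.
Qed.

(** A union bound in exponential form: boundary terms take at most half of eps, so one of the L
    residue sums exceeds n eps / (2L) in absolute value, and one of the 2L exponentials is then at
    least 1. *)
Lemma large_average_exp (N L n : nat) (eps lambda : R) :
  (0 < L)%N -> (0 < n)%N -> 0 <= lambda ->
  (N + N + L)%:R * D <= n%:R * (eps / 2) ->
  eps < `|n%:R^-1 * \sum_(j < n) u j| ->
  1 <= \sum_(r < L)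
    (expR (lambda * (\sum_(i < n %/ L) u (N + (r + i * L))%N) - lambda * (n%:R * (eps / (2 * L%:R)))) +
     expR (lambda * (- \sum_(i < n %/ L) u (N + (r + i * L))%N) - lambda * (n%:R * (eps / (2 * L%:R))))).
Proof.
move=> L0 n0 l0 nbig large.
have n0' : 0 < n%:R :> R by rewrite ltr0n.
have L0' : 0 < L%:R :> R by rewrite ltr0n.
have big1 : n%:R * eps < `|\sum_(j < n) u j|.
  by move: large; rewrite normrM normfV (gtr0_norm n0') mulrC ltr_pdivlMr// mulrC.
have big2 : n%:R * (eps / 2) < `|\sum_(j < n %/ L * L) u (N + j)%N|.
  have kn : (n %/ L * L <= n <= n %/ L * L + L)%N.
    by rewrite leq_divM /= {1}(divn_eq n L) leq_add2l ltnW// ltn_mod.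
  have := norm_sum_shift_le N kn.
  have := lerB_dist (\sum_(j < n) u j) (\sum_(j < n %/ L * L) u (N + j)%N).
  lra.
rewrite -(sum_residues (fun j => u (N + j)%N)) in big2.
have [r Hr] : exists r : 'I_L, n%:R * (eps / (2 * L%:R)) <
    `|\sum_(i < n %/ L) u (N + (r + i * L))%N|.
  apply: contrapT => /forallNP nE; move: big2; apply/negP; rewrite -leNgt.
  rewrite (le_trans (ler_norm_sum _ _ _))//.
  rewrite (@le_trans _ _ (\sum_(r < L) n%:R * (eps / (2 * L%:R))))//.
    by apply: ler_sum => r _; rewrite leNgt; apply/negP/nE.
  rewrite sumr_const card_ord -[X in X <= _]mulr_natr le_eqVlt; apply/orP; left; apply/eqP.
  by field; rewrite gt_eqF.
rewrite (bigD1 r)//= -[leLHS]addr0 lerD//; last first.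
  by apply: sumr_ge0 => j _; rewrite addr_ge0 ?expR_ge0.
move: Hr; set x := \sum_(i < _) _; set y := n%:R * _.
have [x0|x0] := ger0P x => Hr.
  rewrite -[leLHS]addr0 lerD ?expR_ge0// -expR0 ler_expR -mulrBr mulr_ge0//.
  lra.
rewrite -[leLHS]add0r lerD ?expR_ge0// -expR0 ler_expR -mulrBr mulr_ge0//.
lra.
Qed.

End block_sums.

(** * Bounds on the numerator and the denominator of the conditional probability *)

Section large_deviations.
Context {R : realType} {d : nat}.
Variables (P : probability (env R d) R) (Q : R.-pker (env R d) ~> traj d).
Hypotheses (P_iid : iid P) (P_nn : nearest_neighbor P) (Q_law : quenched_law Q).
Variables (theta xi : 'rV[R]_d.+1).

(** The exponential rate common to both bounds; it cancels in their quotient. *)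
Definition rate_at : R := dot theta xi - ln (phi P theta).

Lemma near_dot (n : nat) (delta : R) (s : seq (lattice d)) : (0 < n)%N ->
  near_path xi delta n s ->
  `|dot theta (embed R (path_of s n)) - n%:R * dot theta xi| <= n%:R * (norm1 theta * delta).
Proof.
move=> n0 near; have n0' : 0 < n%:R :> R by rewrite ltr0n.
have -> : embed R (path_of s n) = n%:R *: (n%:R^-1 *: embed R (path_of s n) - xi) + n%:R *: xi.
  by rewrite scalerBr scalerA divff ?gt_eqF// scale1r subrK.
rewrite dotDr !dotZr addrK normrM (gtr0_norm n0') ler_pM2l//.
by rewrite (le_trans (dot_le _ _))// ler_wpM2l// norm1_ge0.
Qed.

Lemma dot_path_le (s : seq (lattice d)) : all (mem (@sphere R d)) s ->
  `|dot theta (embed R (path_of s (size s)))| <= (size s)%:R * norm1 theta.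
Proof.
rewrite path_of_size; elim: s => [|z s IH] /=.
  by rewrite big_nil embed0 dot0r normr0 mul0r.
move=> /andP[zS sS]; rewrite big_cons embedD dotDr (le_trans (ler_normD _ _))//.
rewrite -nat1r mulrDl mul1r lerD// ?IH//.
rewrite (le_trans (dot_le _ _))// ler_piMr ?norm1_ge0//.
by move: zS; rewrite mem_sphere /on_sphere /= => /eqP ->.
Qed.

Lemma measurable_near_velocity n delta :
  measurable (near_velocity (R := R) xi n delta : set (env R d * traj d)).
Proof.
rewrite -[X in measurable X]setTI.
exact: (@measurable_traj_eval R d n measurableT
  [set y : lattice d | enorm (n%:R^-1 *: embed R y - xi) <= delta]).
Qed.

Lemma path_measurable_indic (A : set (env R d * traj d)) : measurable A ->
  path_measurable (fun w s => \1_A (recenter s w, path_of s) : R).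
Proof.
move=> mA s; exact: (measurableT_comp (measurableT_comp (measurable_indic mA)
  (measurable_pair2 (path_of s))) (measurable_recenter s)).
Qed.

(** On the event the path weight is at most e^(n (rate + |theta|_1 delta)), so the original
    probability is at least the tilted one, itself at least 1/2, divided by this factor. *)
Lemma near_velocity_ge (delta : R) : grad_log_phi P theta xi -> 0 < delta ->
  exists n0 : nat, forall n, (n0 <= n)%N ->
  ((2^-1 * expR (- (n%:R * (rate_at + norm1 theta * delta))))%:E <=
   semidirect P Q (near_velocity xi n delta))%E.
Proof.
move=> grad delta0; have [n0 Hn0] := tilted_near_path_ge P_iid P_nn Q_law grad delta0.
exists (maxn n0 1) => n; rewrite geq_max => /andP[n0n n1].
have mD := measurable_near_velocity n delta.
have t0 z : 0 <= tilt P theta z by exact: expR_ge0.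
have -> : semidirect P Q (near_velocity xi n delta) =
    (\int[semidirect P Q]_p (\1_(near_velocity xi n delta) p)%:E)%E.
  by rewrite integral_indic// setIT.
rewrite (@walk_tilted _ _ P Q P_iid P_nn Q_law n (\1_(near_velocity xi n delta))); last first.
- by move=> w X X' XX'; rewrite !indicE; congr ((nat_of_bool _)%:R);
  apply/idP/idP; rewrite !inE /near_velocity /= XX'.
- by move=> p; rewrite indicE.
- exact: measurable_indic.
have mF : path_measurable (fun (_ : env R d) s => (near_path xi delta n s)%:R : R) by move=> s.
set c := expR _.
apply: (@le_trans _ _ (tilted P (tilt P theta) n
  (fun (_ : env R d) s => c * (near_path xi delta n s)%:R))%R).
  rewrite tiltedZ ?expR_ge0// mulrC EFinM lee_wpmul2l ?lee_fin ?expR_ge0//.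
  exact: Hn0.
apply: tilted_le => //.
- exact: path_measurable_indic.
- by move=> w s; rewrite mulr_ge0 ?expR_ge0.
- move=> w s sn; rewrite big1_eq mulr1.
  case: (boolP (near_path xi delta n s)) => sD; last by rewrite mulr0 mul0r.
  rewrite mulr1 indicE mem_set// prod_tilt (size_paths sn) /c -expRD [leRHS]/(1 : R) -[leRHS]expR0 ler_expR.
  have := near_dot n1 sD; rewrite ler_norml => /andP[_].
  by rewrite /rate_at; lra.
Qed.

Variables (mu : probability (env R d * steps R d)%type R).
Hypothesis mu_int : forall (N M K : nat) (f : env R d * steps R d -> R),
  local_observable N M K f ->
  (\int[mu]_p (f p)%:E =
   \int[semidirect P Q]_p
     (expR (dot theta (embed R (p.2 (N + M + K + 1)%N))
            - (N + M + K + 1)%:R * ln (phi P theta))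
      * f (shift_env N%:Z (p.2 N) p.1, steps_after R N p.2))%:E)%E.
Variables (N M K : nat) (f : env R d * steps R d -> R).
Hypothesis f_obs : local_observable N M K f.
Let L := (N + M + K + 1)%N.

Lemma measurable_deviation n eps : measurable (deviation f mu n eps).
Proof.
have [mf _ _ _] := f_obs.
pose g (p : env R d * traj d) := `| n%:R^-1 *
  (\sum_(j < n) f (shift_env j%:Z (p.2 j) p.1, steps_after R j p.2)) - \int[mu]_r f r |.
have mg : measurable_fun setT g.
  apply: measurableT_comp => //; apply: measurable_funB => //.
  apply: measurable_funM => //; apply: measurable_sum => j.
  exact: measurable_observable_at.
rewrite (_ : deviation f mu n eps = setT `&` g @^-1` `]eps, +oo[%classic).
  exact: mg.
by rewrite setTI; apply/seteqP; split => p /=; rewrite in_itv /= andbT.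
Qed.

Lemma observable_at_path n (w : env R d) (X X' : traj d) j : (j < n)%N ->
  (forall i, (i <= n + L)%N -> X i = X' i) ->
  f (shift_env j%:Z (X j) w, steps_after R j X) =
  f (shift_env j%:Z (X' j) w, steps_after R j X').
Proof.
move=> jn XX'; rewrite XX'; last by lia.
apply: (observable_local f_obs) => // i iK.
by rewrite /steps_after !XX'// /L; lia.
Qed.

(** The quantifier order matters: [c], [K1] and [n0] come before [delta], so that [delta] can later
    be taken small compared with [c]. *)
Lemma deviation_near_velocity_le (eps : R) : 0 < eps ->
  exists c K1 : R, 0 < c /\ exists n0 : nat, forall n delta, (n0 <= n)%N -> 0 < delta ->
   (semidirect P Q (deviation f mu n eps `&` near_velocity xi n delta) <=
    (expR (K1 - n%:R * (rate_at - norm1 theta * delta) - n%:R * c))%:E)%E.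
Proof.
move=> eps0.
have [C C0 fC] : exists2 C : R, 0 < C & forall p, `|f p| <= C.
  have [_ [C fC] _ _] := f_obs; exists (C + 1) => [|p].
    by rewrite ltr_pwDr// (le_trans _ (fC point)).
  by rewrite (le_trans (fC p))// lerDl.
have L0 : (0 < L)%N by rewrite /L; lia.
have L0' : 0 < L%:R :> R by rewrite ltr0n.
pose m := \int[mu]_r f r.
(* The first bound keeps 2 lambda C within 1/3, the range of the quadratic estimate; the second
   makes the quadratic cost [q] at most [c]. *)
pose lambda := Num.min (6 * C)^-1 (eps / (16 * L%:R * C ^+ 2)).
have l0 : 0 < lambda.
  by rewrite lt_min invr_gt0 mulr_gt0//= divr_gt0// !mulr_gt0// exprn_gt0.
have lC : lambda * (2 * C) <= 3^-1.
  apply: (@le_trans _ _ ((6 * C)^-1 * (2 * C))).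
    by rewrite ler_wpM2r ?ge_min ?lexx// mulr_ge0// ltW.
  by rewrite le_eqVlt; apply/orP; left; apply/eqP; field; rewrite gt_eqF.
pose q := (lambda * (2 * C)) ^+ 2.
(* The Chernoff gain [eta] below equals 2nc; the moment generating function costs at most nc, which
   leaves nc. *)
pose c := lambda * (eps / (4 * L%:R)).
have qc : q <= c.
  rewrite /q /c (_ : (lambda * (2 * C)) ^+ 2 = lambda * (lambda * (4 * C ^+ 2))); last by ring.
  rewrite ler_pM2l//.
  apply: (@le_trans _ _ (eps / (16 * L%:R * C ^+ 2) * (4 * C ^+ 2))).
    by rewrite ler_wpM2r ?ge_min ?lexx ?orbT// mulr_ge0// exprn_ge0// ltW.
  rewrite le_eqVlt; apply/orP; left; apply/eqP; field.
  by rewrite !gt_eqF.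
(* The first term pays for the weight of the L steps after time n; the second bounds the logarithm
   of 2L, the number of exponentials in the union bound. *)
pose K1 : R := L%:R * (norm1 theta + `|ln (phi P theta)|) + (2 * L%:R).
exists c, K1; split; first by rewrite mulr_gt0// divr_gt0// mulr_gt0.
have [n0 Hn0] := @eventually_ge_linear R (eps / 2) ((N + N + L)%:R * (C + C)) (divr_gt0 eps0 (ltr0Sn R 1)).
exists (maxn n0 1) => n delta; rewrite geq_max => /andP[/Hn0 nbig n1] delta0.
have t0 z : 0 <= tilt P theta z by exact: expR_ge0.
have t1 := tilt_normalized P_iid P_nn Q_law theta.
pose W := window N f.
have mW : path_measurable W by exact: path_measurable_window f_obs.
have lW : local_levels L W by exact: local_levels_window f_obs.
have WC w s : `|W w s| <= C by exact: fC.
have hm : tilted P (tilt P theta) L (fun w s => W w s + C) = (m + C)%:E.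
  exact: (tilted_window_mean P_iid P_nn Q_law mu_int f_obs fC).
have mC : `|m| <= C by exact: (tilted_mean_bound P_iid t0 t1 mW WC hm).
have hmN := tilted_mean_opp P_iid t0 t1 mW WC hm.
have mWN : path_measurable (fun w s => - W w s).
  by move=> s; apply: measurableT_comp => //; exact: mW.
have lWN : local_levels L (fun w s => - W w s) by move=> w w' s ww'; rewrite (lW w w').
have WCN w s : `|- W w s| <= C by rewrite normrN.
pose k := (n %/ L)%N.
pose S (r : nat) (w : env R d) s : R := \sum_(i < k)
  (W (shift_env (r + i * L)%N%:Z 0 w) (take L (drop (r + i * L) s)) - m).
pose eta := lambda * (n%:R * (eps / (2 * L%:R))).
have mS r : path_measurable (S r).
  move=> s; apply: measurable_sum => i; apply: measurable_funB => //.
  exact: (measurableT_comp (mW _) (measurable_relabel (fun x => (x.1 + _, x.2 + 0)))).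
pose E1 r (w : env R d) s := expR (- eta) * expR (lambda * S r w s).
pose E2 r (w : env R d) s := expR (- eta) * expR (lambda * (- S r w s)).
have mE1' r : path_measurable (fun w s => expR (lambda * S r w s)).
  by move=> s; apply: measurableT_comp => //; apply: measurable_funM => //; exact: mS.
have mE2' r : path_measurable (fun w s => expR (lambda * (- S r w s))).
  move=> s; apply: measurableT_comp => //; apply: measurable_funM => //.
  by apply: measurableT_comp => //; exact: mS.
have mE1 r : path_measurable (E1 r) by move=> s; apply: measurable_funM => //; exact: mE1'.
have mE2 r : path_measurable (E2 r) by move=> s; apply: measurable_funM => //; exact: mE2'.
have E10 r w s : 0 <= E1 r w s by rewrite mulr_ge0 ?expR_ge0.
have E20 r w s : 0 <= E2 r w s by rewrite mulr_ge0 ?expR_ge0.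
(* The horizon splits into [r] free steps, [k] full windows and a remainder, as
   [tilted_progression_mgf_le] requires; the L extra steps leave room for every [r]. *)
have horizon (r : 'I_L) : (n + L = r + (k * L + (n + L - r - k * L)))%N.
  by have := ltn_ord r; have := leq_divM n L; rewrite /k; lia.
have kq : k%:R * q <= n%:R * c.
  by rewrite ler_pM ?ler0n ?sqr_ge0// ler_nat leq_div.
have bE1 (r : 'I_L) : (tilted P (tilt P theta) (n + L) (E1 r) <= (expR (- eta + n%:R * c))%:E)%E.
  rewrite tiltedZ ?expR_ge0//.
  rewrite expRD EFinM lee_wpmul2l ?lee_fin ?expR_ge0// {1}(horizon r).
  apply: le_trans (tilted_progression_mgf_le P_iid t0 t1 mW WC lW k r _ hm (ltW l0) lC) _.
  by rewrite lee_fin ler_expR.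
have bE2 (r : 'I_L) : (tilted P (tilt P theta) (n + L) (E2 r) <= (expR (- eta + n%:R * c))%:E)%E.
  rewrite tiltedZ ?expR_ge0//.
  rewrite expRD EFinM lee_wpmul2l ?lee_fin ?expR_ge0// {1}(horizon r).
  have := tilted_progression_mgf_le P_iid t0 t1 mWN WCN lWN k r (n + L - r - k * L) hmN (ltW l0) lC.
  rewrite (_ : (fun w s => expR (lambda * \sum_(i < k) _)) =
    (fun w s => expR (lambda * (- S r w s)))); last first.
    apply/funext => w; apply/funext => s; congr (expR (_ * _)).
    by rewrite /S -sumrN; apply: eq_bigr => i _; rewrite opprB opprK addrC.
  by move=> /le_trans; apply; rewrite lee_fin ler_expR.
pose c1 := expR (L%:R * (norm1 theta + `|ln (phi P theta)|)
   - n%:R * (rate_at - norm1 theta * delta)).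
pose B (w : env R d) s : R := \sum_(r < L) (E1 r w s + E2 r w s).
have mE12 (r : 'I_L) : path_measurable (fun w s => E1 r w s + E2 r w s).
  by move=> s; apply: measurable_funD; [exact: mE1|exact: mE2].
have mB : path_measurable B by move=> s; apply: measurable_sum => r; exact: mE12.
have B0 w s : 0 <= B w s by apply: sumr_ge0 => r _; rewrite addr_ge0.
have bB : (tilted P (tilt P theta) (n + L) B <= (2 * L%:R * expR (- eta + n%:R * c))%:E)%E.
  rewrite tilted_sum//; last by move=> i w s; rewrite addr_ge0.
  apply: (@le_trans _ _ (\sum_(r < L) (2 * expR (- eta + n%:R * c))%:E)%E).
    apply: lee_sum => r _; rewrite tiltedD// mulr_natl mulr2n EFinD leeD//.
  by rewrite sumEFin lee_fin sumr_const card_ord -[X in X <= _]mulr_natr mulrAC.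
set A := deviation f mu n eps `&` near_velocity xi n delta.
have mA : measurable A.
  by apply: measurableI; [exact: measurable_deviation|exact: measurable_near_velocity].
have -> : semidirect P Q A = (\int[semidirect P Q]_p (\1_A p)%:E)%E.
  by rewrite integral_indic// setIT.
rewrite (@walk_tilted _ _ P Q P_iid P_nn Q_law (n + L) (\1_A)); last first.
- move=> w X X' XX'; rewrite !indicE; congr ((nat_of_bool _)%:R).
  have XO j : (j < n)%N -> f (shift_env j%:Z (X j) w, steps_after R j X) =
     f (shift_env j%:Z (X' j) w, steps_after R j X').
    by move=> jn; exact: (observable_at_path _ jn XX').
  have sumE : \sum_(j < n) f (shift_env j%:Z (X j) w, steps_after R j X) =
     \sum_(j < n) f (shift_env j%:Z (X' j) w, steps_after R j X').
    by apply: eq_bigr => j _; exact: XO.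
  have Xn : X n = X' n by apply: XX'; rewrite leq_addr.
  by apply/idP/idP; rewrite !inE /A /deviation /near_velocity /= sumE Xn.
- by move=> p; rewrite indicE.
- exact: measurable_indic.
(* Change of measure: on [A], [c1] times the path weight is at least 1 by closeness of the velocity,
   and [B] is at least 1 by the large deviation of the average. *)
apply: (@le_trans _ _ (tilted P (tilt P theta) (n + L) (fun w s => c1 * B w s)%R)); last first.
  rewrite tiltedZ ?expR_ge0//.
  apply: (@le_trans _ _ (c1%:E * (2 * L%:R * expR (- eta + n%:R * c))%:E)%E).
    by rewrite lee_wpmul2l ?lee_fin ?expR_ge0.
  rewrite -EFinM lee_fin mulrCA.
  apply: (@le_trans _ _ (expR (2 * L%:R) * (c1 * expR (- eta + n%:R * c)))).
    rewrite ler_wpM2r ?mulr_ge0 ?expR_ge0// (le_trans _ (expR_ge1Dx _))// lerDr.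
    by [].
  rewrite /c1 -!expRD ler_expR le_eqVlt; apply/orP; left; apply/eqP.
  by rewrite /K1 /eta /c; field; rewrite gt_eqF.
apply: tilted_le => //.
- exact: path_measurable_indic.
- by move=> s; apply: measurable_funM => //; exact: mB.
move=> w s sn; rewrite big1_eq mulr1 indicE.
case: (boolP (_ \in A)) => [|_]; last by rewrite !mulr_ge0 ?expR_ge0// prodr_ge0.
rewrite inE => -[Adev Anear].
have sL := size_paths sn.
rewrite mulrAC -[leLHS]mulr1 ler_pM//.
  rewrite /c1 prod_tilt sL -expRD -[leLHS]expR0 ler_expR.
  have h1 := near_dot n1 Anear.
  have [allS dropS] : all (mem (@sphere R d)) (drop n s) /\ size (drop n s) = L.
    split; last by rewrite size_drop sL addKn.
    move: sn; rewrite mem_paths => /andP[_ /allP sS].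
    by apply/allP => z /mem_drop; exact: sS.
  have := dot_path_le allS; rewrite dropS path_of_drop => h2.
  have pE : path_of s (n + L)%N = path_of s n + (path_of s (n + L)%N - path_of s n).
    by rewrite addrC subrK.
  rewrite pE embedD dotDr.
  move: h1 h2; rewrite !ler_norml => /andP[h1 _] /andP[h2 _].
  have h3 := ler_norm (ln (phi P theta)).
  have h4 : 0 <= L%:R * (`|ln (phi P theta)| - ln (phi P theta)).
    by rewrite mulr_ge0// subr_ge0.
  rewrite natrD /rate_at; lra.
pose u j : R := f (shift_env j%:Z (path_of s j) (recenter s w), steps_after R j (path_of s)) - m.
have uD j : `|u j| <= C + C by rewrite (le_trans (ler_normB _ _))// lerD.
have large : eps < `|n%:R^-1 * \sum_(j < n) u j|.
  by rewrite /u sumrB sumr_const card_ord mulrBr -[m *+ n]mulr_natl mulKf ?pnatr_eq0 -?lt0n.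
have := large_average_exp uD L0 n1 (ltW l0) nbig large.
rewrite (_ : \sum_(r < L) _ = B w s)//; apply: eq_bigr => r _.
(* A window starting at level [r + i * L] evaluates [f] at the time N later, whence the offset N in
   [u]. *)
have SE : \sum_(i < n %/ L) u (N + (r + i * L))%N = S r w s.
  apply: eq_bigr => i _; rewrite /u [(N + _)%N]addnC (observable_window f_obs)// sL.
  rewrite leq_add2r (leq_trans _ (leq_divM n L))//.
  apply: (@leq_trans (i.+1 * L)); last by rewrite leq_mul2r ltn_ord orbT.
  by rewrite mulSn leq_add2r ltnW.
by rewrite SE /E1 /E2 -/eta !expRD ![_ * expR (- eta)]mulrC.
Qed.

End large_deviations.

Lemma limn_esup_le_eventually (R : realType) (u : (\bar R)^nat) (l : \bar R) (n0 : nat) :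
  (forall n, (n0 <= n)%N -> (u n <= l)%E) -> (limn_esup u <= l)%E.
Proof.
move=> ul; rewrite limn_esup_lim (cvg_lim _ (@cvg_esups_inf _ u))//.
apply: (@le_trans _ _ (esups u n0)); first by apply: ereal_inf_lbound; exists n0.
by apply: ge_ereal_sup => _ [n /= n0n <-]; exact: ul.
Qed.

Theorem theorem1 (R : realType) (d : nat)
    (P : probability (env R d) R) (Q : R.-pker (env R d) ~> (traj d))
    (P_iid : iid P) (P_nn : nearest_neighbor P) (P_ue : uniformly_elliptic P)
    (Q_law : quenched_law Q)
    (xi : 'rV[R]_d.+1) (xi_int : interior (dom_rate P) xi)
    (mu : probability (env R d * steps R d)%type R)
    (mu_bar : is_mu_bar P Q xi mu)
    (N M K : nat) (f : env R d * steps R d -> R)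
    (f_obs : local_observable N M K f)
    (eps : R) (eps_gt0 : 0 < eps) :
  exists2 delta0 : R, 0 < delta0 &
    forall delta : R, 0 < delta -> delta < delta0 ->
      (limn_esup (fun n : nat => (n%:R^-1)%:E *
         lne (cond_prob (semidirect P Q)
                (deviation f mu n eps) (near_velocity xi n delta))) < 0)%E.
Proof.
have [theta grad mu_int] := mu_bar.
have [c [K1 [c0 [n1 Hup]]]] := deviation_near_velocity_le P_iid P_nn Q_law xi mu_int f_obs eps_gt0.
set B := norm1 theta in Hup; have B0 : 0 <= B by exact: norm1_ge0.
have B1 : 0 < B + 1 by rewrite ltr_wpDl.
(* This makes 2 B delta at most c / 2, where 2 B delta is the combined loss of the two changes of
   measure; the added 1 covers theta = 0. *)
exists (c / (4 * (B + 1))); first by rewrite divr_gt0// mulr_gt0.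
move=> delta delta0 deltac.
have Bdelta : 2 * (B * delta) <= c / 2.
  have : delta * (4 * (B + 1)) < c by rewrite -ltr_pdivlMr// mulr_gt0.
  by have := mulr_ge0 B0 (ltW delta0); lra.
have [n2 Hlow] := near_velocity_ge P_iid P_nn Q_law grad delta0.
(* The constants, including ln 2 from the factor 1/2 in the lower bound, consume c / 4 of the
   remaining rate c / 2. *)
have [n3 H3] := @eventually_ge_linear R (c / 4) (K1 + ln 2) (divr_gt0 c0 (ltr0Sn R 3)).
apply: (@le_lt_trans _ _ (- (c / 4))%:E); last by rewrite lte_fin oppr_lt0 divr_gt0.
apply: (@limn_esup_le_eventually _ _ _ (maxn (maxn n1 n2) (maxn n3 1))) => n.
rewrite !geq_max => /andP[/andP[n1n n2n] /andP[n3n n_gt0]].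
have n0 : 0 < n%:R :> R by rewrite ltr0n.
have := Hup n delta n1n delta0; have := Hlow n n2n; rewrite -/B.
set a := expR (K1 - _ - _); set b := 2^-1 * expR _.
have b0 : 0 < b by rewrite mulr_gt0 ?expR_gt0.
rewrite /cond_prob.
set X := semidirect P Q (_ `&` _); set Y := semidirect P Q (near_velocity _ _ _) => bY Xa.
have X0 : (0 <= X)%E by exact: measure_ge0.
have [y yE] : exists y, Y = y%:E.
  exists (fine Y); rewrite fineK// ge0_fin_numE ?measure_ge0//.
  by rewrite (le_lt_trans (probability_le1 _ (measurable_near_velocity xi n delta)))// ltry.
rewrite yE lee_fin in bY; have y0 : 0 < y by exact: lt_le_trans bY.
have ratio : (X / Y <= (a / b)%:E)%E.
  rewrite yE inver gt_eqF// EFinM.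
  apply: lee_pmul => //; first by rewrite lee_fin invr_ge0 ltW.
  by rewrite lee_fin lef_pV2.
have ratio0 : (0 <= X / Y)%E by rewrite yE inver gt_eqF// mule_ge0// lee_fin invr_ge0 ltW.
have ab0 : 0 < a / b by rewrite divr_gt0// expR_gt0.
(* The ratio may be 0; monotonicity of [lne] on all of [0, +oo] covers that case. *)
apply: (@le_trans _ _ ((n%:R^-1)%:E * (ln (a / b))%:E)%E).
  apply: lee_wpmul2l; first by rewrite lee_fin invr_ge0 ltW.
  rewrite -lne_EFin// lee_lne//.
    by rewrite in_itv /= ratio0 leey.
  by rewrite in_itv /= lee_fin ltW//= leey.
rewrite -EFinM lee_fin ler_pdivrMl//.
have -> : ln (a / b) = K1 + ln 2 + n%:R * (2 * (B * delta) - c).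
  rewrite ln_div ?posrE ?expR_gt0// /b lnM ?posrE ?expR_gt0// lnV ?posrE// !expRK.
  ring.
have := H3 n n3n.
have : n%:R * (2 * (B * delta)) <= n%:R * (c / 2) by rewrite ler_pM2l.
lra.
Qed.
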